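(* Let $\sigma^2>0$, let $\nu$ be a probability distribution supported on an ellipsoid $\{\theta\in\mathbb{R}^d:\|A\theta\|_2=1\}$ ($A$ symmetric positive semi-definite), $H=\mathbb{E}_\nu[\theta\theta^\top]$, $\tilde X=H^{1/2}X$, $\Sigma_H=H^{1/2}\Sigma H^{1/2}$, and assume there is $L_H>0$ with $\mathbb{E}[\|\tilde X\|_2^2\,\tilde X\tilde X^\top]\preceq L_H^2\Sigma_H$. Then $$C_{\sigma,L_H}\,\frac{\sigma^2}{n}\,\mathrm{df}_2(\Sigma_H;\lambda_{\sigma,L_H})\le\bar{\mathcal{E}}(\Sigma_H;\sigma^2)-\bar{\mathcal{E}}(\Sigma_H;0),$$ where: (i) if $L_H^2<\sigma^2$, one may take $C_{\sigma,L_H}=1-L_H^2/\sigma^2$ and $\lambda_{\sigma,L_H}=(\sigma^2+L_H^2)/n$; (ii) if $\|\tilde X\|_2^2\le L_H^2$ almost surely, one may take $C_{\sigma,L_H}=1/(1+L_H^2/\sigma^2)^2$ and $\lambda_{\sigma,L_H}=\sigma^2/n$.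
   Context: Setting: $(X,Y)\in\mathbb{R}^d\times\mathbb{R}$ satisfies $Y=X^\top\theta_\star+\epsilon$ with $\mathbb{E}[\epsilon\mid X]=0$, $\mathbb{E}[\epsilon^2\mid X]=\sigma^2$; $\Sigma=\mathbb{E}[XX^\top]$. Training data $(X_i,Y_i)_{i\in[n]}$ are i.i.d. copies of $(X,Y)$, independent of a test pair. A linear prediction rule is $\hat f(x)=\sum_{i=1}^n l_i(x)Y_i$ with each $l_i$ a (possibly random) function of $x$, $(X_i)_{i\in[n]}$ and independent randomness. $R(f)=\mathbb{E}[(Y-f(X))^2]$, $\mathcal{E}_{s}(\hat f)=\mathbb{E}[R(\hat f)]-s$ when the noise variance is $s$. $\bar{\mathcal{E}}(\Sigma_H;s)$ denotes $\inf_{\hat f}\mathbb{E}_{\theta_\star\sim\nu}[\mathcal{E}_{s}(\hat f)]$ for noise variance $s$ (infimum over linear prediction rules, $\theta_\star\sim\nu$ independent of the data); $\bar{\mathcal{E}}(\Sigma_H;0)$ is the same quantity for the noiseless model $\epsilon=0$. $\mathrm{df}_2(S;\lambda)=\mathrm{Tr}(S^2(S+\lambda I)^{-2})$. *)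

(* Defs.v *)
From HB Require Import structures.
From mathcomp Require Import all_boot all_order all_algebra.
From mathcomp Require Import all_classical all_reals all_analysis.

Set Implicit Arguments.
Unset Strict Implicit.
Unset Printing Implicit Defensive.

Import Order.TTheory GRing.Theory Num.Theory.
Local Open Scope classical_set_scope.
Local Open Scope ring_scope.

Section Defs.
Context {R : realType} {d n : nat}.

(* vectors of R^d are d-tuples (carrying the product sigma-algebra) *)
Definition tcol (x : d.-tuple R) : 'cV[R]_d := \col_i tnth x i.
Definition dotv (x y : d.-tuple R) : R := \sum_(j < d) tnth x j * tnth y j.
Definition sqnorm (v : 'cV[R]_d) : R := \sum_(j < d) v j 0 ^+ 2.
Definition quad (M : 'M[R]_d) (v : 'cV[R]_d) : R := (v^T *m M *m v) 0 0.
Definition psd (M : 'M[R]_d) : Prop := M^T = M /\ forall v, 0 <= quad M v.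

Definition df2 (S : 'M[R]_d) (lam : R) : R :=
  \tr (S *m S *m invmx ((S + lam%:M) *m (S + lam%:M))).

(* second-moment matrix E[X X^T] under the law mu of (X, eps) *)
Definition Sigma_of (mu : probability (d.-tuple R * R)%type R) : 'M[R]_d :=
  \matrix_(j, k) Rintegral mu setT (fun z => tnth z.1 j * tnth z.1 k).

Definition H_of (nu : probability (d.-tuple R) R) : 'M[R]_d :=
  \matrix_(j, k) Rintegral nu setT (fun t => tnth t j * tnth t k).

(* E[eps | X] = 0 and E[eps^2 | X] = s, stated through the defining
   property of conditional expectation, with eps square integrable *)
Definition noise_cond (mu : probability (d.-tuple R * R)%type R) (s : R) : Prop :=
  mu.-integrable setT (fun z => ((z.2) ^+ 2)%:E) /\
  forall B : set (d.-tuple R), measurable B ->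
    (\int[mu]_(z in fst @^-1` B) (z.2)%:E = 0)%E /\
    (\int[mu]_(z in fst @^-1` B) ((z.2) ^+ 2)%:E = s%:E * mu (fst @^-1` B))%E.

(* A realization of the Bayesian experiment on a probability space P:
   theta ~ nu, Z_0 = (X_0, eps_0) (test pair) and Z_i (i >= 1, training pairs)
   i.i.d. with law mu, and an auxiliary randomness U, all mutually independent. *)
Definition realization {dO} {Omega : measurableType dO} (P : probability Omega R)
  (nu : probability (d.-tuple R) R) (mu : probability (d.-tuple R * R)%type R)
  {dU} {UT : measurableType dU}
  (th : Omega -> d.-tuple R) (Z : 'I_n.+1 -> Omega -> (d.-tuple R * R)%type)
  (U : Omega -> UT) : Prop :=
  [/\ [/\ measurable_fun setT th, (forall i, measurable_fun setT (Z i)) &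
      measurable_fun setT U],
      (forall B, measurable B -> P (th @^-1` B) = nu B),
      (forall i B, measurable B -> P (Z i @^-1` B) = mu B) &
      (forall (Bt : set (d.-tuple R)) (BU : set UT)
              (BZ : 'I_n.+1 -> set (d.-tuple R * R)%type),
         measurable Bt -> measurable BU -> (forall i, measurable (BZ i)) ->
         P (th @^-1` Bt `&` U @^-1` BU `&` \bigcap_(i in setT) (Z i @^-1` BZ i))
         = (P (th @^-1` Bt) * P (U @^-1` BU) * \prod_(i < n.+1) P (Z i @^-1` BZ i))%E)].

Definition train_inputs {Omega : Type} (Z : 'I_n.+1 -> Omega -> (d.-tuple R * R)%type)
  (w : Omega) : n.-tuple (d.-tuple R) :=
  [tuple (Z (lift ord0 i) w).1 | i < n].

Definition resp {Omega : Type} (noisy : bool) (th : Omega -> d.-tuple R)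
  (Z : 'I_n.+1 -> Omega -> (d.-tuple R * R)%type) (i : 'I_n.+1) (w : Omega) : R :=
  dotv (Z i w).1 (th w) + (if noisy then (Z i w).2 else 0).

Definition pred_at_test {Omega : Type} {UT : Type} (noisy : bool)
  (l : 'I_n -> (d.-tuple R * n.-tuple (d.-tuple R)) * UT -> R)
  (th : Omega -> d.-tuple R) (Z : 'I_n.+1 -> Omega -> (d.-tuple R * R)%type)
  (U : Omega -> UT) (w : Omega) : R :=
  \sum_(i < n) l i (((Z ord0 w).1, train_inputs Z w), U w) * resp noisy th Z (lift ord0 i) w.

Definition bayes_excess {dO} {Omega : measurableType dO} (P : probability Omega R)
  {UT : Type} (noisy : bool) (s : R)
  (l : 'I_n -> (d.-tuple R * n.-tuple (d.-tuple R)) * UT -> R)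
  (th : Omega -> d.-tuple R) (Z : 'I_n.+1 -> Omega -> (d.-tuple R * R)%type)
  (U : Omega -> UT) : \bar R :=
  (\int[P]_w ((resp noisy th Z ord0 w - pred_at_test noisy l th Z U w) ^+ 2)%:E
   - s%:E)%E.

Definition Ebar_gen (mu : probability (d.-tuple R * R)%type R)
  (nu : probability (d.-tuple R) R) (noisy : bool) (s : R) : \bar R :=
  ereal_inf [set v : \bar R | exists (dO : measure_display) (Omega : measurableType dO)
     (P : probability Omega R) (dU : measure_display) (UT : measurableType dU)
     (th : Omega -> d.-tuple R) (Z : 'I_n.+1 -> Omega -> (d.-tuple R * R)%type)
     (U : Omega -> UT)
     (l : 'I_n -> (d.-tuple R * n.-tuple (d.-tuple R)) * UT -> R),
     [/\ realization P nu mu th Z U, (forall i, measurable_fun setT (l i)) &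
         v = bayes_excess P noisy s l th Z U]].

Definition Ebar mu nu (s : R) : \bar R := Ebar_gen mu nu true s.
Definition Ebar0 mu nu : \bar R := Ebar_gen mu nu false 0.

End Defs.

(* Main.v *)
(** Averaging over the prior turns the problem into a deterministic one in the
    whitened inputs x = H^{1/2} X: the noisy excess of a rule l is
    E[|x_0 - sum_i l_i x_i|^2 + s |l|^2] (s the noise variance) and its noiseless
    risk is E|x_0 - sum_i l_i x_i|^2.  For fixed inputs the former is minimised by
    the ridge weights l* = X^T (S + s)^{-1} x_0, where S = X X^T, and l* is an
    admissible rule for the noiseless problem, so the gap is at least
    s E|l*|^2 = s E tr(Sg M S M), with M = (S + s)^{-1} and Sg = Sigma_H.

    Linearising the trace at the deterministic matrix B = (n Sg + s + L^2)^{-1}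
    bounds it below by an affine function of S and S^2.  Since E S = n Sg and
    E S^2 <= n (n - 1) Sg^2 + n L^2 Sg, this gives
    gap >= (s / n) df2(Sg; (s + L^2) / n), with constant 1.  Case (i) is weaker,
    and so is case (ii), because t + s + L^2 <= (1 + L^2 / s) (t + s) for t >= 0. *)

Require Import Defs.
From HB Require Import structures.
From mathcomp Require Import all_boot all_order all_algebra.
From mathcomp Require Import all_classical all_reals all_analysis.
From mathcomp Require Import measurable_realfun ring lra.
Set Implicit Arguments.
Unset Strict Implicit.
Unset Printing Implicit Defensive.

Import Order.TTheory GRing.Theory Num.Theory.
Local Open Scope classical_set_scope.
Local Open Scope ring_scope.

(** * Integration against variables with constant conditional mean *)

(** An admissible rule is an arbitrary measurable function, so its risk may be infinite and its
    weights need not be integrable. The averaging identities are therefore proved for integrals in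
    [0, +oo], and conditional expectation is replaced by equality of integrals over the sets of a
    sub-sigma-algebra. Two conditionings occur: on all inputs and the auxiliary randomness, which
    averages out theta and the noises, and on the training inputs alone, which averages out the test
    input. The infimum ranges over all probability spaces carrying the experiment, so the ridge rule
    is compared with l on the realization that carries l; one realization has to be built to know
    that the noiseless infimum is finite before subtracting it. No spectral decomposition is used:
    Sigma_H enters through tr(Sigma_H W) >= 0 for W with nonnegative quadratic form, immediate from
    Sigma_H = E x x^T. The matrix B is chosen because the moment bounds read E[S^2 + s S] <= n
    Sigma_H B^{-1}; the terms of the affine minorant then contribute 4, -2 and -1 times n tr(Sg B Sg
    B) = df2 / n, whence the constant 1. *)

Section CondConst.
Context {d} {T : measurableType d} {R : realType} (P : probability T R).
Variable G : set (set T).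
Hypothesis GM : <<s G >> `<=` measurable.

(** [g_sigma_algebraType G] is [T] with the sigma-algebra generated by [G], so the general lemmas on
    measurable functions apply to the smaller information as well. *)
Definition sub_measurable (h : T -> R) :=
  measurable_fun (setT : set (g_sigma_algebraType G)) (h : g_sigma_algebraType G -> R).

Lemma sub_measurable_fun h : sub_measurable h -> measurable_fun setT h.
Proof. by move=> mh _ B mB; apply: GM; exact: mh. Qed.

Lemma sub_measurable_norm h : sub_measurable h -> sub_measurable (fun t => `|h t|).
Proof.
move=> mh.
by apply: (@measurableT_comp _ _ _ (g_sigma_algebraType G) _ _ (@Num.norm _ R) setT h).
Qed.

Lemma sub_measurableM f g : sub_measurable f -> sub_measurable g ->
  sub_measurable (fun t => f t * g t).
Proof. exact: (@measurable_funM _ (g_sigma_algebraType G)). Qed.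

Lemma sub_measurable_indic (B : set T) : <<s G >> B -> sub_measurable (\1_B : T -> R).
Proof. by move=> sB; apply: (@measurable_indic _ (g_sigma_algebraType G)). Qed.

Import HBNNSimple.

(** [h] is an increasing limit of simple functions for the smaller sigma-algebra; the integral
    against such a function is a sum over its level sets, which belong to [<<s G >>], where the
    hypothesis applies. Both sides may be [+oo]. *)
Lemma ge0_integral_sub_eq (f1 f2 h : T -> R) :
  (forall t, 0 <= f1 t) -> (forall t, 0 <= f2 t) -> (forall t, 0 <= h t) ->
  measurable_fun setT f1 -> measurable_fun setT f2 -> sub_measurable h ->
  (forall B, <<s G >> B -> \int[P]_(t in B) (f1 t)%:E = \int[P]_(t in B) (f2 t)%:E)%E ->
  (\int[P]_t (h t * f1 t)%:E = \int[P]_t (h t * f2 t)%:E)%E.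
Proof.
move=> f10 f20 h0 mf1 mf2 mh f12.
pose hG : g_sigma_algebraType G -> R := h.
have mhE : @measurable_fun _ _ (g_sigma_algebraType G) (\bar R) setT (EFin \o hG).
  exact/measurable_EFinP.
pose g := nnsfun_approx measurableT mhE.
have mg n : measurable_fun (setT : set T) (g n).
  by apply: sub_measurable_fun; exact: measurable_funPT.
have lim (f : T -> R) : (forall t, 0 <= f t) -> measurable_fun setT f ->
    (\int[P]_t (h t * f t)%:E = limn (fun n => \int[P]_t (g n t * f t)%:E))%E.
  move=> f0 mf.
  rewrite -monotone_convergence//=.
  - apply: eq_integral => t _; apply/esym/cvg_lim => //.
    have gh : (EFin \o g ^~ t) n @[n --> \oo] --> (h t)%:E.
      by apply: (@cvg_nnsfun_approx _ _ _ _ _ _ mhE) => // ? _ /=; rewrite lee_fin.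
    under eq_fun do rewrite EFinM.
    rewrite EFinM; apply: cvgeZr => //.
  - move=> n; apply/measurable_EFinP; exact: measurable_funM.
  - by move=> n t _; rewrite lee_fin mulr_ge0.
  - move=> t _ m n mn; rewrite lee_fin ler_wpM2r//.
    by have /lefP := nd_nnsfun_approx measurableT mhE mn; exact.
have dec (f : T -> R) n : (forall t, 0 <= f t) -> measurable_fun setT f ->
    (\int[P]_t (g n t * f t)%:E = \sum_(k \in range (g n))
       k%:E * \int[P]_(t in g n @^-1` [set k]) (f t)%:E)%E.
  move=> f0 mf.
  have mpre k : measurable (g n @^-1` [set k] : set T).
    by have := mg n measurableT _ (measurable_set1 k); rewrite setTI.
  under eq_integral => t _.
    rewrite fimfunE /= mulrC mulr_fsumr// -fsumEFin//.
    over.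
  rewrite ge0_integral_fsum//=; last 2 first.
  - move=> k; apply/measurable_EFinP; apply: measurable_funM => //.
    apply: measurable_funM => //; exact: measurable_indic.
  - move=> k t _; rewrite lee_fin mulr_ge0//.
    rewrite indicE; case: (boolP (t \in _)) => [|_]; last by rewrite mulr0.
    by rewrite inE /= => <-; rewrite mulr1.
  apply: eq_fsbigr => k; rewrite inE => -[t0 _ gk].
  rewrite -ge0_integralZl//=; last 3 first.
  - by apply/measurable_EFinP; exact: measurable_funTS.
  - by move=> t _; rewrite lee_fin.
  - by rewrite lee_fin -gk.
  rewrite [RHS]integral_mkcond; apply: eq_integral => t _.
  rewrite patchE indicE; case: ifPn => _; rewrite ?mulr1 ?mulr0//.
  by rewrite mulrC EFinM.
rewrite !lim//; congr (limn _); apply/funext => n; rewrite !dec//.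
apply: eq_fsbigr => k _; rewrite f12//.
by have := measurable_funPT (g n) measurableT _ (measurable_set1 k); rewrite setTI.
Qed.

End CondConst.

(** * Real-valued integrals on a probability space *)

Section RintegralFacts.
Context {d} {T : measurableType d} {R : realType} (P : probability T R).
Implicit Types (f g : T -> R).

Definition rintegrable f := P.-integrable setT (EFin \o f).

Lemma rintegrable_measurable f : rintegrable f -> measurable_fun setT f.
Proof. by move=> /measurable_int /measurable_EFinP. Qed.

Lemma rintegrableD f g : rintegrable f -> rintegrable g ->
  rintegrable (fun t => f t + g t).
Proof. by move=> /integrableD /[apply]; apply. Qed.

Lemma rintegrableB f g : rintegrable f -> rintegrable g ->
  rintegrable (fun t => f t - g t).
Proof. by move=> /integrableB /[apply]; apply. Qed.

Lemma rintegrableZ k f : rintegrable f -> rintegrable (fun t => k * f t).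
Proof. by move=> /integrableZl; apply. Qed.

Lemma rintegrable_cst k : rintegrable (fun=> k).
Proof. by have := finite_measure_integrable_cst P k measurableT. Qed.

Lemma rintegrable_norm f : rintegrable f -> rintegrable (fun t => `|f t|).
Proof. by move=> /integrable_norm. Qed.

Lemma rintegrable_sum (I : Type) (r : seq I) (Q : pred I) (F : I -> T -> R) :
  (forall i, Q i -> rintegrable (F i)) ->
  rintegrable (fun t => \sum_(i <- r | Q i) F i t).
Proof.
move=> iF; rewrite /rintegrable (_ : _ \o _ =
  fun t => (\sum_(i <- r | Q i) (F i t)%:E)%E); first exact: integrable_sum.
by apply/funext => t /=; rewrite sumEFin.
Qed.

Lemma rintegrable_le f g : measurable_fun setT f -> rintegrable g ->
  (forall t, `|f t| <= `|g t|) -> rintegrable f.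
Proof.
move=> mf ig fg; apply: le_integrable ig => //; first exact/measurable_EFinP.
by move=> t _; rewrite lee_fin.
Qed.

Lemma rintegrableM f g : measurable_fun setT f -> measurable_fun setT g ->
  rintegrable (fun t => f t ^+ 2) -> rintegrable (fun t => g t ^+ 2) ->
  rintegrable (fun t => f t * g t).
Proof.
move=> mf mg if2 ig2; apply: (rintegrable_le _ (rintegrableD if2 ig2)).
  exact: measurable_funM.
move=> t; rewrite normrM [leRHS]ger0_norm ?addr_ge0 ?sqr_ge0//.
rewrite -(real_normK (num_real (f t))) -(real_normK (num_real (g t))).
have := sqr_ge0 (`|f t| - `|g t|); have := normr_ge0 (f t).
by have := normr_ge0 (g t); nra.
Qed.

Lemma rintegrableMb f g (M : R) : measurable_fun setT f -> rintegrable g ->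
  (forall t, `|f t| <= M) -> rintegrable (fun t => f t * g t).
Proof.
move=> mf ig fM; apply: (rintegrable_le _ (rintegrableZ M ig)).
  by apply: measurable_funM => //; exact: rintegrable_measurable.
move=> t; rewrite !normrM ler_wpM2r//; apply: le_trans (fM t) _.
exact: ler_norm.
Qed.

Lemma EFin_Rintegral f : rintegrable f ->
  (\int[P]_t (f t)%:E = (Rintegral P setT f)%:E)%E.
Proof. by move=> fi; rewrite /Rintegral fineK//; exact: integrable_fin_num. Qed.

Lemma Rintegral_sum (I : Type) (r : seq I) (Q : pred I) (F : I -> T -> R) :
  (forall i, Q i -> rintegrable (F i)) ->
  Rintegral P setT (fun t => \sum_(i <- r | Q i) F i t) =
  \sum_(i <- r | Q i) Rintegral P setT (F i).
Proof.
move=> iF; elim: r => [|i r IH].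
  under eq_Rintegral do rewrite big_nil.
  by rewrite Rintegral_cst// mul0r big_nil.
rewrite big_cons -IH; case: ifPn => Qi.
  rewrite -RintegralD//.
  - by apply: eq_Rintegral => t _; rewrite big_cons Qi.
  - exact: iF.
  - exact: rintegrable_sum.
by apply: eq_Rintegral => t _; rewrite big_cons (negbTE Qi).
Qed.

Lemma fine_probability_setT : fine (P setT) = 1.
Proof. exact: (congr1 fine (probability_setT P)). Qed.

Lemma Rintegral_cstT k : Rintegral P setT (fun=> k) = k.
Proof. by rewrite Rintegral_cst// fine_probability_setT mulr1. Qed.

Lemma Rintegral_indicM f (B : set T) :
  Rintegral P B f = Rintegral P setT (fun t => \1_B t * f t).
Proof.
rewrite /Rintegral [in LHS]integral_mkcond; congr fine; apply: eq_integral => t _.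
by rewrite patchE indicE; case: ifPn => _; rewrite ?mul1r ?mul0r.
Qed.

End RintegralFacts.

Section CondZero.
Context {d} {T : measurableType d} {R : realType} (P : probability T R).
Variable G : set (set T).
Hypothesis GM : <<s G >> `<=` measurable.
Let intg := rintegrable P.

(** Neither factor has a sign. The sign of [V] is handled by comparing the nonnegative variables
    [|V| + V] and [|V| - V], which have equal integrals over every set of [<<s G >>]; that of [h] by
    writing [2 h] as the difference of [|h| + h] and [|h| - h]. *)
Lemma integral_sub_eq0 (V h : T -> R) : intg V -> sub_measurable G h ->
  intg (fun t => h t * V t) ->
  (forall B, <<s G >> B -> Rintegral P B V = 0) ->
  Rintegral P setT (fun t => h t * V t) = 0.
Proof.
move=> iV mh ihV V0.
have mV := rintegrable_measurable iV.
have mhT := sub_measurable_fun GM mh.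
have inV := rintegrable_norm iV.
(* The factor 2 covers both [|h| + h] and [|h| - h]. *)
have pos (g : T -> R) : (forall t, 0 <= g t) -> sub_measurable G g ->
    (forall t, `|g t| <= 2 * `|h t|) ->
    intg (fun t => g t * V t) /\ Rintegral P setT (fun t => g t * V t) = 0.
  move=> g0 mg gh.
  have mgT := sub_measurable_fun GM mg.
  have igV : intg (fun t => g t * V t).
    apply: (rintegrable_le _ (rintegrableZ 2 ihV)); first exact: measurable_funM.
    move=> t; rewrite !normrM mulrA ler_wpM2r// (le_trans (gh t))// ler_wpM2r//.
    by rewrite ger0_norm.
  split=> //.
  have ignV : intg (fun t => g t * `|V t|).
    apply: (rintegrable_le _ igV); last by move=> t; rewrite !normrM normr_id.
    by apply: measurable_funM => //; exact: measurableT_comp.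
  have : (\int[P]_t (g t * (`|V t| + V t))%:E =
          \int[P]_t (g t * (`|V t| - V t))%:E)%E.
    apply: (ge0_integral_sub_eq GM) => //.
    - by move=> t; rewrite -lerBlDr sub0r -normrN ler_norm.
    - by move=> t; rewrite subr_ge0 ler_norm.
    - by apply: measurable_funD => //; exact: measurableT_comp.
    - by apply: measurable_funB => //; exact: measurableT_comp.
    move=> B sB; have mB := GM sB.
    have iVB : P.-integrable B (EFin \o V) by exact: integrableS iV.
    have inVB : P.-integrable B (EFin \o (fun t => `|V t|)) by exact: integrableS inV.
    rewrite -[LHS]fineK; last by apply: integrable_fin_num => //; exact: (integrableD mB inVB iVB).
    rewrite -[RHS]fineK; last by apply: integrable_fin_num => //; exact: (integrableB mB inVB iVB).
    congr EFin; have := RintegralD mB inVB iVB; have := RintegralB mB inVB iVB.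
    by rewrite V0// addr0 subr0 /Rintegral => -> ->.
  rewrite !EFin_Rintegral; last 2 first.
  - have := rintegrableB ignV igV; apply: eq_integrable => // t _ /=.
    by rewrite mulrBr.
  - have := rintegrableD ignV igV; apply: eq_integrable => // t _ /=.
    by rewrite mulrDr.
  under eq_Rintegral do rewrite mulrDr.
  under [X in _ = X%:E]eq_Rintegral do rewrite mulrBr.
  rewrite RintegralD// RintegralB// => -[]; lra.
have mnh := sub_measurable_norm mh.
have [|||i1 E1] := pos (fun t => `|h t| + h t).
- by move=> t; rewrite -lerBlDr sub0r -normrN ler_norm.
- exact: (@measurable_funD _ (g_sigma_algebraType G)).
- by move=> t; rewrite (le_trans (ler_normD _ _))// normr_id; lra.
have [|||i2 E2] := pos (fun t => `|h t| - h t).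
- by move=> t; rewrite subr_ge0 ler_norm.
- exact: (@measurable_funB _ (g_sigma_algebraType G)).
- by move=> t; rewrite (le_trans (ler_normB _ _))// normr_id; lra.
have := RintegralB measurableT i1 i2; rewrite E1 E2 subr0.
rewrite (@eq_Rintegral _ _ _ _ _ (fun t => 2 * (h t * V t))); last first.
  by move=> t _; ring.
by rewrite RintegralZl//; lra.
Qed.

Lemma integral_sub_const (W h : T -> R) (w : R) : intg W -> sub_measurable G h ->
  intg h -> intg (fun t => h t * W t) ->
  (forall B, <<s G >> B -> Rintegral P B W = w * fine (P B)) ->
  Rintegral P setT (fun t => h t * W t) = w * Rintegral P setT h.
Proof.
move=> iW mh ih ihW HW.
have iV := rintegrableB iW (rintegrable_cst P w).
have ihV : intg (fun t => h t * (W t - w)).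
  have := rintegrableB ihW (rintegrableZ w ih); apply: eq_integrable => // t _ /=.
  by rewrite mulrBr (mulrC w).
have := integral_sub_eq0 iV mh ihV.
rewrite (@eq_Rintegral _ _ _ _ _ (fun t => h t * W t - w * h t)); last first.
  by move=> t _; ring.
rewrite RintegralB//; last exact: rintegrableZ.
rewrite RintegralZl// => H; apply/eqP; rewrite -subr_eq0; apply/eqP; apply: H.
move=> B sB; have mB := GM sB.
rewrite RintegralB//; [|exact: integrableS iW|exact: finite_measure_integrable_cst].
by rewrite HW// Rintegral_cst// subrr.
Qed.

(** The measurable sets over which [W - w] integrates to zero form a Dynkin system, and [G] is a
    pi-system. *)
Lemma Rintegral_dynkin (W : T -> R) (w : R) : intg W ->
  setI_closed G -> G setT ->
  (forall B, G B -> Rintegral P B W = w * fine (P B)) ->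
  forall B, <<s G >> B -> Rintegral P B W = w * fine (P B).
Proof.
move=> iW GI GT HG B0 sB0.
pose V := fun t => W t - w.
have iV : intg V := rintegrableB iW (rintegrable_cst P w).
have VE B : measurable B -> Rintegral P B V = Rintegral P B W - w * fine (P B).
  move=> mB; rewrite RintegralB//; [by rewrite Rintegral_cst|exact: integrableS iW|].
  exact: finite_measure_integrable_cst.
have gM B : G B -> measurable B by move=> GB; apply: GM; exact: sub_sigma_algebra.
have finV B : measurable B -> (\int[P]_(t in B) (V t)%:E)%E \is a fin_num.
  by move=> mB; apply: integrable_fin_num => //; exact: integrableS iV.
pose D := [set B | measurable B /\ (\int[P]_(t in B) (V t)%:E = 0)%E].
suff : D B0.
  move=> [mB V0]; apply/eqP; rewrite -subr_eq0 -VE// /Rintegral V0//.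
have GD : G `<=` D.
  move=> B GB; split; first exact: gM.
  rewrite -[LHS]fineK; last by apply: finV; exact: gM.
  by congr EFin; have := VE _ (gM _ GB); rewrite HG// subrr.
have dD : dynkin D.
  split; first exact: GD.
  - move=> B [mB B0']; split; first exact: measurableC.
    have := (GD _ GT).2; rewrite -(setvU B) integral_setU//=.
    + by rewrite B0' adde0.
    + exact: measurableC.
    + apply/measurable_EFinP/measurable_funTS; exact: rintegrable_measurable iV.
    + by apply/disj_setPS => t [].
  - move=> F tF DF; split; first by apply: bigcup_measurable => k _; have [] := DF k.
    rewrite integral_bigcup//; last 2 first.
    + by move=> k; have [] := DF k.
    + by apply: integrableS iV => //; apply: bigcup_measurable => k _; have [] := DF k.
    by rewrite eseries0// => k _ _; have [] := DF k.
have := sB0; rewrite -setI_closed_g_dynkin_g_sigma_algebra// => /(_ D); apply.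
by split.
Qed.

End CondZero.

(** * Conditional second moment of a random linear form *)

Section CondSecondMoment.
Context {d} {T : measurableType d} {R : realType} (P : probability T R).
Variable G : set (set T).
Hypotheses (GM : G `<=` measurable) (GI : setI_closed G) (GT : G setT).
Let intg := rintegrable P.

Let sGM : <<s G >> `<=` measurable.
Proof. by apply: smallest_sub GM; exact: sigma_algebra_measurable. Qed.

(* Truncating on the events [max_a `|c a| <= m] makes every product integrable;
   monotone convergence then removes the truncation. *)
Lemma cond_second_moment (A : finType) (e c : A -> T -> R) (D : A -> A -> R) :
  (forall a, measurable_fun setT (e a)) ->
  (forall a b, intg (fun t => e a t * e b t)) ->
  (forall a b B, G B ->
     Rintegral P B (fun t => e a t * e b t) = D a b * fine (P B)) ->
  (forall a, sub_measurable G (c a)) ->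
  (forall v : A -> R, 0 <= \sum_a \sum_b D a b * (v a * v b)) ->
  (\int[P]_t ((\sum_a c a t * e a t) ^+ 2)%:E =
   \int[P]_t (\sum_a \sum_b D a b * (c a t * c b t))%:E)%E.
Proof.
move=> me iee HD mc D0.
have mcT a : measurable_fun setT (c a) by exact: sub_measurable_fun (mc a).
pose F m := [set t | forall a, `|c a t| <= m%:R].
have FE m : F m = \bigcap_(a in setT) [set t | `|c a t| <= m%:R].
  by apply/seteqP; split => t /= H a; [move=> _; exact: H|exact: H].
have sF m : <<s G >> (F m).
  have : @measurable _ (g_sigma_algebraType G) (F m).
    rewrite FE; apply: fin_bigcap_measurable => // a _.
    have mn := sub_measurable_norm (mc a).
    have := mn measurableT _ (measurable_itv `]-oo, m%:R]); rewrite setTI.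
    by congr (measurable _); apply/seteqP; split => t /=; rewrite in_itv.
  by [].
have mF m : measurable (F m) by exact: sGM.
have ndF : nondecreasing_seq F.
  move=> m n mn; apply/subsetPset => t Ft a; apply: le_trans (Ft a) _.
  by rewrite ler_nat.
have UF : \bigcup_m F m = setT.
  apply/seteqP; split => // t _.
  exists (Num.truncn (\sum_a `|c a t|)).+1 => // a.
  apply: le_trans (ltW (truncnS_gt _)); rewrite (bigD1 a)//= lerDl.
  exact: sumr_ge0.
have trunc m : Rintegral P (F m) (fun t => (\sum_a c a t * e a t) ^+ 2) =
    Rintegral P (F m) (fun t => \sum_a \sum_b D a b * (c a t * c b t)) /\
    intg (fun t => \1_(F m) t * (\sum_a c a t * e a t) ^+ 2) /\
    intg (fun t => \1_(F m) t * (\sum_a \sum_b D a b * (c a t * c b t))).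
  (* On [F m] the product of two coefficients is bounded by [m ^ 2] and stays measurable for the
     conditioning, so its product with [e a * e b] is integrable. *)
  pose h a b t := \1_(F m) t * (c a t * c b t).
  have hb a b t : `|h a b t| <= m%:R ^+ 2.
    rewrite /h indicE; case: (boolP (t \in F m)) => [|_]; last first.
      by rewrite mul0r normr0 exprn_ge0.
    by rewrite inE => Ft; rewrite mul1r normrM expr2 ler_pM.
  have sh a b : sub_measurable G (h a b).
    apply: sub_measurableM; last exact: sub_measurableM.
    exact: sub_measurable_indic (sF m).
  have mh a b : measurable_fun setT (h a b) by exact: sub_measurable_fun (sh a b).
  have ih a b : intg (h a b).
    apply: (rintegrable_le (mh a b) (rintegrable_cst P (m%:R ^+ 2))) => t.
    by rewrite [leRHS]ger0_norm ?exprn_ge0.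
  have ihe a b : intg (fun t => h a b t * (e a t * e b t)).
    exact: rintegrableMb (hb a b).
  have E1 t : \1_(F m) t * (\sum_a c a t * e a t) ^+ 2 =
      \sum_a \sum_b h a b t * (e a t * e b t).
    rewrite expr2 mulr_suml mulr_sumr; apply: eq_bigr => a _.
    rewrite !mulr_sumr; apply: eq_bigr => b _; rewrite /h; ring.
  have E2 t : \1_(F m) t * (\sum_a \sum_b D a b * (c a t * c b t)) =
      \sum_a \sum_b D a b * h a b t.
    rewrite mulr_sumr; apply: eq_bigr => a _.
    rewrite mulr_sumr; apply: eq_bigr => b _; rewrite /h; ring.
  have i1 : intg (fun t => \sum_a \sum_b h a b t * (e a t * e b t)).
    by do 2 (apply: rintegrable_sum => ? _).
  have i2 : intg (fun t => \sum_a \sum_b D a b * h a b t).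
    by do 2 (apply: rintegrable_sum => ? _); exact: rintegrableZ.
  split; last first.
    by split; [move: i1|move: i2]; apply: eq_integrable => // t _ /=;
      rewrite ?E1 ?E2.
  rewrite [LHS]Rintegral_indicM [RHS]Rintegral_indicM.
  under eq_Rintegral do rewrite E1.
  under [RHS]eq_Rintegral do rewrite E2.
  rewrite Rintegral_sum; last by move=> a _; apply: rintegrable_sum.
  rewrite Rintegral_sum; last first.
    by move=> a _; apply: rintegrable_sum => b _; exact: rintegrableZ.
  apply: eq_bigr => a _; rewrite Rintegral_sum// Rintegral_sum; last first.
    by move=> b _; exact: rintegrableZ.
  apply: eq_bigr => b _; rewrite RintegralZl//; last exact: ih.
  apply: (integral_sub_const sGM) => //.
  exact: (Rintegral_dynkin sGM (iee a b) GI GT (HD a b)).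
have cv (f : T -> R) : measurable_fun setT f -> (forall t, 0 <= f t) ->
    (\int[P]_(t in F m) (f t)%:E)%E @[m --> \oo] --> (\int[P]_t (f t)%:E)%E.
  move=> mf f0; rewrite -[in X in _ --> X]UF.
  apply: ge0_nondecreasing_set_cvg_integral => //.
    by move=> m; apply/measurable_EFinP; exact: measurable_funTS.
  by move=> m t _; rewrite lee_fin.
have m1 : measurable_fun setT (fun t => (\sum_a c a t * e a t) ^+ 2).
  apply: measurable_funX; apply: measurable_sum => a; exact: measurable_funM.
have m2 : measurable_fun setT (fun t => \sum_a \sum_b D a b * (c a t * c b t)).
  apply: measurable_sum => a; apply: measurable_sum => b.
  by apply: measurable_funM => //; exact: measurable_funM.
have := cv _ m1 (fun t => sqr_ge0 _).
rewrite (_ : (fun m => _) = (fun m => \int[P]_(t in F m)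
    (\sum_a \sum_b D a b * (c a t * c b t))%:E)%E); last first.
  apply/funext => m; have [E [j1 j2]] := trunc m.
  have fin (f : T -> R) : intg (fun t => \1_(F m) t * f t) ->
      (\int[P]_(t in F m) (f t)%:E)%E \is a fin_num.
    move=> jf; rewrite integral_mkcond.
    rewrite (eq_integral (fun t => (\1_(F m) t * f t)%:E)).
      exact: integrable_fin_num.
    move=> t _; rewrite patchE indicE; case: ifPn => _; by rewrite ?mul1r ?mul0r.
  by rewrite -[LHS]fineK ?fin// -[RHS]fineK ?fin//; congr EFin.
(* Positivity of the form [D] makes the right-hand integrand nonnegative, so monotone convergence
   applies there too, even when the limit is [+oo]. *)
move=> c1; have c2 := cv _ m2 (fun t => D0 (c ^~ t)).
apply: (cvg_unique _ c1 c2); exact: ereal_hausdorff.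
Qed.

End CondSecondMoment.

(** * Independence *)

Section Independence.
Context {d} {T : measurableType d} {R : realType} (P : probability T R).
Context {K : finType}.
Variable G : K -> set (set T).
Hypothesis GM : forall k, <<s G k >> `<=` measurable.
Hypothesis indep : forall E : K -> set T, (forall k, <<s G k >> (E k)) ->
  (P (\bigcap_(k in setT) E k) = \prod_k P (E k))%E.
Let intg := rintegrable P.

Let fine_prodP (E : K -> set T) : (forall k, measurable (E k)) ->
  fine (\prod_k P (E k))%E = \prod_k fine (P (E k)).
Proof.
move=> mE; rewrite (eq_bigr (fun k => (fine (P (E k)))%:E)) ?prodEFin//.
by move=> k _; rewrite fineK//; exact: fin_num_measure.
Qed.

Let indic_prod (E : K -> set T) t :
  \prod_k \1_(E k) t = \1_(\bigcap_(k in setT) E k) t :> R.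
Proof.
rewrite [RHS]indicE; case: (boolP (t \in _)) => [|/negP].
  rewrite inE => tE; rewrite big1// => k _.
  by rewrite indicE mem_set//; exact: tE.
rewrite inE => tE; have [k tk] : exists k, ~ E k t.
  by apply/existsNP => H; apply: tE => k _; exact: H.
by rewrite (bigD1 k)//= indicE memNset// mul0r.
Qed.

Lemma rintegrable_indic (B : set T) : measurable B -> intg (\1_B).
Proof. by move=> mB; exact: integrable_indic. Qed.

Lemma Rintegral_indic (B : set T) : measurable B ->
  Rintegral P setT (\1_B) = fine (P B).
Proof. by move=> mB; rewrite /Rintegral integral_indic// setIT. Qed.

(* The indicators are replaced by integrable functions one factor at a time. *)
Lemma Rintegral_prod_indep (f : K -> T -> R) :
  (forall k, sub_measurable (G k) (f k)) -> (forall k, intg (f k)) ->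
  intg (fun t => \prod_k f k t) /\
  Rintegral P setT (fun t => \prod_k f k t) = \prod_k Rintegral P setT (f k).
Proof.
pose good (g : K -> T -> R) k := sub_measurable (G k) (g k) /\ intg (g k).
(* [s] lists the coordinates whose factor is still arbitrary; outside [s] the factors are
   indicators, so the empty list is the product rule for events. *)
suff H (s : seq K) (g : K -> T -> R) : (forall k, good g k) ->
    (forall k, k \notin s -> exists2 E, <<s G k >> E & g k = \1_E) ->
    intg (fun t => \prod_k g k t) /\
    Rintegral P setT (fun t => \prod_k g k t) = \prod_k Rintegral P setT (g k).
  move=> mf fi; apply: (H (enum K)) => [k|k]; first by split.
  by rewrite mem_enum.
elim: s g => [|k0 s IH] g gg gE.
  have /choice[E HE] : forall k, exists E, <<s G k >> E /\ g k = \1_E.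
    by move=> k; have [E ? ?] := gE k isT; exists E.
  have mE k : measurable (E k) by apply: (@GM k); have [] := HE k.
  have mI : measurable (\bigcap_(k in setT) E k) by exact: fin_bigcap_measurable.
  have -> : (fun t => \prod_k g k t) = \1_(\bigcap_(k in setT) E k).
    apply/funext => t; rewrite -indic_prod; apply: eq_bigr => k _.
    by rewrite (HE k).2.
  split; first exact: rintegrable_indic.
  rewrite Rintegral_indic// indep; last by move=> k; have [] := HE k.
  rewrite fine_prodP//; apply: eq_bigr => k _.
  by rewrite (HE k).2 Rintegral_indic.
pose upd (u : K -> T -> R) h k : T -> R := if k == k0 then h else u k.
have updE u h t : \prod_k upd u h k t = h t * \prod_(k | k != k0) u k t.
  rewrite (bigD1 k0)//= /upd eqxx; congr (_ * _).
  by apply: eq_bigr => k /negbTE ->.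
have updR u h : \prod_k Rintegral P setT (upd u h k) =
    Rintegral P setT h * \prod_(k | k != k0) Rintegral P setT (u k).
  rewrite (bigD1 k0)//= /upd eqxx; congr (_ * _).
  by apply: eq_bigr => k /negbTE ->.
(* With an indicator at [k0], the induction hypothesis says that the product of the other factors
   has constant mean over the sets of [<<s G k0 >>]; the factor at [k0] can then be pulled out. *)
have key (u : K -> T -> R) : (forall k, good u k) ->
    (forall k, k \notin k0 :: s -> exists2 E, <<s G k >> E & u k = \1_E) ->
    intg (fun t => \prod_(k | k != k0) u k t) /\
    forall B, <<s G k0 >> B ->
      Rintegral P B (fun t => \prod_(k | k != k0) u k t) =
      (\prod_(k | k != k0) Rintegral P setT (u k)) * fine (P B).
  move=> gu uE.
  have main B : <<s G k0 >> B ->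
      intg (fun t => \1_B t * \prod_(k | k != k0) u k t) /\
      Rintegral P setT (fun t => \1_B t * \prod_(k | k != k0) u k t) =
      fine (P B) * (\prod_(k | k != k0) Rintegral P setT (u k)).
    move=> sB; have mB : measurable B by exact: GM sB.
    have [||i e] := IH (upd u \1_B).
    - move=> k; rewrite /good /upd; case: eqVneq => [->|_]; last exact: gu.
      split; last exact: rintegrable_indic.
      exact: sub_measurable_indic.
    - move=> k ks; rewrite /upd; case: eqVneq => [->|kk0]; first by exists B.
      by apply: uE; rewrite inE negb_or kk0.
    split; first by move: i; apply: eq_integrable => // t _ /=; rewrite updE.
    by rewrite -Rintegral_indic// -updR -e; apply: eq_Rintegral => t _; rewrite updE.
  split; last by move=> B sB; rewrite Rintegral_indicM (main _ sB).2 mulrC.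
  have sT : <<s G k0 >> setT.
    have := @measurableT _ (g_sigma_algebraType (G k0)); by [].
  have [+ _] := main _ sT; apply: eq_integrable => // t _ /=.
  by rewrite indicT mul1r.
have [iW HW] := key g gg gE.
(* The absolute values satisfy the same hypotheses; they serve to prove that the whole product is
   integrable before its integral is computed. *)
have gna k : good (fun k t => `|g k t|) k.
  split; first by apply: sub_measurable_norm; have [] := gg k.
  by apply: rintegrable_norm; have [] := gg k.
have gnE k : k \notin k0 :: s ->
    exists2 E, <<s G k >> E & (fun t => `|g k t|) = \1_E.
  move=> /gE[E sE ->]; exists E => //; apply/funext => t.
  by rewrite ger0_norm// indicE.
have [iWa HWa] := key (fun k t => `|g k t|) gna gnE.
have [mg0 ig0] := gg k0.
set W := fun t => \prod_(k | k != k0) g k t in iW HW.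
set Wa := fun t => \prod_(k | k != k0) `|g k t| in iWa HWa.
set wa := \prod_(k | k != k0) Rintegral P setT (fun t => `|g k t|) in HWa.
have wa0 : 0 <= wa by apply: prodr_ge0 => k _; exact: Rintegral_ge0.
have mW := rintegrable_measurable iW.
have mg0T : measurable_fun setT (g k0) by exact: sub_measurable_fun mg0.
have igW : intg (fun t => g k0 t * W t).
  apply/integrableP; split; first by apply/measurable_EFinP; exact: measurable_funM.
  rewrite (eq_integral (fun t => (`|g k0 t| * Wa t)%:E)); last first.
    by move=> t _; rewrite /= normrM /Wa /W -normr_prod.
  rewrite (@ge0_integral_sub_eq _ _ _ P (G k0) _ _ (fun=> wa))//.
  - have := rintegrableZ wa (rintegrable_norm ig0).
    rewrite (eq_integral (fun t => (wa * `|g k0 t|)%:E)); last first.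
      by move=> t _; rewrite mulrC.
    by move=> i; apply: integrable_lty.
  - by move=> t; exact: prodr_ge0.
  - exact: rintegrable_measurable iWa.
  - exact: sub_measurable_norm.
  - move=> B sB; have mB : measurable B by exact: GM sB.
    rewrite -[LHS]fineK; last first.
      by apply: integrable_fin_num => //; exact: integrableS iWa.
    rewrite -[RHS]fineK; last first.
      by apply: integrable_fin_num => //; exact: finite_measure_integrable_cst.
    by congr EFin; rewrite [LHS]HWa// [RHS]Rintegral_cst.
have gE' t : \prod_k g k t = g k0 t * W t by rewrite (bigD1 k0).
split; first by move: igW; apply: eq_integrable => // t _ /=; rewrite gE'.
rewrite (@eq_Rintegral _ _ _ _ _ (fun t => g k0 t * W t)); last by move=> t _; rewrite gE'.
by rewrite (integral_sub_const (@GM k0) iW mg0 ig0 igW HW) [RHS](bigD1 k0)//= mulrC.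
Qed.

Variable Q : K -> set (set T).
Hypothesis QG : forall k, Q k `<=` <<s G k >>.

(** A pi-system generating the information retained in a conditioning: [Q k] is the part of
    coordinate [k] that is kept, and [Q k] reduced to [setT] forgets that coordinate. *)
Definition rects : set (set T) :=
  [set \bigcap_(k in setT) E k | E in [set E | forall k, Q k (E k)]].

Lemma rects_measurable : rects `<=` measurable.
Proof.
move=> _ [E QE <-]; apply: fin_bigcap_measurable => // k _.
by apply: (@GM k); exact: QG.
Qed.

Lemma rects_setI : (forall k, setI_closed (Q k)) -> setI_closed rects.
Proof.
move=> QI _ _ [E QE <-] [F QF <-]; exists (fun k => E k `&` F k).
  by move=> k; exact: QI.
by rewrite bigcapI.
Qed.

Lemma rects_setT : (forall k, Q k setT) -> rects setT.
Proof. by move=> QT; exists (fun=> setT) => //; rewrite bigcapT. Qed.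

(** The indicator of a rectangle factors along the coordinates, so constant means of the factors
    over the [Q k] multiply to a constant mean of the product. *)
Lemma Rintegral_rects (f : K -> T -> R) (m : K -> R) :
  (forall k, sub_measurable (G k) (f k)) -> (forall k, intg (f k)) ->
  (forall k E, Q k E -> Rintegral P E (f k) = m k * fine (P E)) ->
  forall B, rects B ->
  Rintegral P B (fun t => \prod_k f k t) = (\prod_k m k) * fine (P B).
Proof.
move=> mf fi fm _ [E QE <-].
have sE k : <<s G k >> (E k) by exact: QG.
have mE k : measurable (E k) by exact: GM (sE k).
rewrite indep// fine_prodP// -big_split/=.
rewrite Rintegral_indicM.
have [|k|_ e] := @Rintegral_prod_indep (fun k t => \1_(E k) t * f k t).
- by move=> k; apply: sub_measurableM => //; exact: sub_measurable_indic.
- apply: (@rintegrableMb _ _ _ _ _ _ 1) => //.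
  by move=> t; rewrite indicE; case: (_ \in _); rewrite ?normr1 ?normr0.
rewrite (@eq_Rintegral _ _ _ _ _ (fun t => \prod_k (\1_(E k) t * f k t))); last first.
  by move=> t _; rewrite big_split/= indic_prod.
by rewrite e; apply: eq_bigr => k _; rewrite -Rintegral_indicM fm.
Qed.

End Independence.

(** * Change of variables and the events generated by a random variable *)

Section Law.
Context {d d'} {T : measurableType d} {T' : measurableType d'} {R : realType}.
Variables (P : probability T R) (m : probability T' R) (V : T -> T').
Hypothesis mV : measurable_fun setT V.
Hypothesis lawV : forall B, measurable B -> P (V @^-1` B) = m B.

Lemma ge0_integral_law (g : T' -> \bar R) (B : set T') : measurable B ->
  measurable_fun setT g -> (forall t, 0 <= g t)%E ->
  (\int[P]_(t in V @^-1` B) g (V t) = \int[m]_(t in B) g t)%E.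
Proof.
move=> mB mg g0.
rewrite -(@ge0_integral_pushforward _ _ _ _ _ V mV P B g)//.
  have mpf := @isMeasurableFun.Build _ _ _ _ _ mV.
  pose Vm : {mfun T >-> T'} := HB.pack V mpf.
  have := @eq_measure_integral _ T' R B m (pushforward P Vm) g; apply.
  by move=> A mA _; exact: lawV.
exact: measurable_funTS.
Qed.

Lemma rintegrable_law (g : T' -> R) : rintegrable m g -> rintegrable P (g \o V).
Proof.
move=> ig; have mg := rintegrable_measurable ig.
apply/integrableP; split.
  by apply/measurable_EFinP; exact: measurableT_comp.
have /integrableP[_] := ig.
rewrite -(ge0_integral_law measurableT)//.
by apply: measurableT_comp => //; exact/measurable_EFinP.
Qed.

Lemma Rintegral_law (g : T' -> R) (B : set T') : measurable B ->
  rintegrable m g ->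
  Rintegral P (V @^-1` B) (g \o V) = Rintegral m B g.
Proof.
move=> mB ig; have mg := rintegrable_measurable ig.
have mVB : measurable (V @^-1` B) by rewrite -[_ @^-1` _]setTI; exact: mV.
(* [g] is the difference of two nonnegative integrable functions, to which the nonnegative change of
   variables applies. *)
pose h1 t := `|g t| + g t; pose h2 t := `|g t|.
have i2 : rintegrable m h2 by exact: rintegrable_norm.
have i1 : rintegrable m h1 by exact: rintegrableD.
have E (h : T' -> R) : (forall t, 0 <= h t) -> rintegrable m h ->
    Rintegral P (V @^-1` B) (h \o V) = Rintegral m B h.
  move=> h0 ih; rewrite /Rintegral -[in RHS]ge0_integral_law//.
  apply/measurable_EFinP; exact: rintegrable_measurable ih.
have gE t : g t = h1 t - h2 t by rewrite /h1 /h2 addrC addKr.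
rewrite (@eq_Rintegral _ _ _ _ _ (fun t => (h1 \o V) t - (h2 \o V) t)); last first.
  by move=> t _ /=; rewrite gE.
rewrite [RHS](@eq_Rintegral _ _ _ _ _ (fun t => h1 t - h2 t)); last first.
  by move=> t _ /=.
have h10 t : 0 <= h1 t by rewrite /h1 -lerBlDr sub0r -normrN ler_norm.
have h20 t : 0 <= h2 t by rewrite /h2.
have j1 : m.-integrable B (EFin \o h1) by exact: integrableS i1.
have j2 : m.-integrable B (EFin \o h2) by exact: integrableS i2.
have k1 : P.-integrable (V @^-1` B) (EFin \o (h1 \o V)).
  exact: integrableS (rintegrable_law i1).
have k2 : P.-integrable (V @^-1` B) (EFin \o (h2 \o V)).
  exact: integrableS (rintegrable_law i2).
by rewrite (RintegralB mVB k1 k2) (RintegralB mB j1 j2) !E.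
Qed.

Definition preimages : set (set T) := [set V @^-1` B | B in measurable].

(** Preimages commute with complements and countable unions. An event generated by [V] is therefore
    literally the preimage of a measurable set, the form in which [realization] states
    independence. *)
Lemma preimages_sigma : <<s preimages >> = preimages.
Proof.
apply: sigma_algebra_id; split.
- by exists set0; rewrite ?preimage_set0.
- move=> _ [B mB <-]; exists (~` B); first exact: measurableC.
  by rewrite setTD preimage_setC.
- move=> F HF; have /choice[B HB] : forall k, exists B, measurable B /\ V @^-1` B = F k.
    by move=> k; have [B mB e] := HF k; exists B.
  exists (\bigcup_k B k); first by apply: bigcup_measurable => k _; exact: (HB k).1.
  rewrite preimage_bigcup; apply: eq_bigcupr => k _; exact: (HB k).2.
Qed.

Lemma preimages_measurable : <<s preimages >> `<=` measurable.
Proof.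
by rewrite preimages_sigma => _ [B mB <-]; rewrite -[_ @^-1` _]setTI; exact: mV.
Qed.

Lemma sub_measurable_preimages (g : T' -> R) : measurable_fun setT g ->
  sub_measurable preimages (g \o V).
Proof.
move=> mg _ B mB; rewrite setTI; apply: sub_sigma_algebra.
exists (g @^-1` B) => //; by rewrite -[_ @^-1` _]setTI; exact: mg.
Qed.

End Law.

(** * The independent blocks of the experiment *)

Section Realization.
Context {R : realType} {d n : nat} {dO} {Omega : measurableType dO}.
Variables (P : probability Omega R).
Context {dU} {UT : measurableType dU}.
Variables (nu : probability (d.-tuple R) R) (mu : probability (d.-tuple R * R)%type R).
Variables (th : Omega -> d.-tuple R) (Z : 'I_n.+1 -> Omega -> (d.-tuple R * R)%type)
  (U : Omega -> UT).
Hypothesis real : realization P nu mu th Z U.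

(** Index of the independent blocks: [inl true] for theta, [inl false] for [U], and [inr i] for the
    pair [Z i]. *)
Definition coord : finType := (bool + 'I_n.+1)%type.

Definition coord_sigma (k : coord) : set (set Omega) :=
  match k with
  | inl true => preimages th
  | inl false => preimages U
  | inr i => preimages (Z i)
  end.

Lemma coord_sigma_measurable k : <<s coord_sigma k >> `<=` measurable.
Proof.
have [[mth mZ mU] _ _ _] := real.
by case: k => [[]|i] /=; exact: preimages_measurable.
Qed.

Lemma coord_sigmaE k : <<s coord_sigma k >> = coord_sigma k.
Proof. by case: k => [[]|i] /=; rewrite preimages_sigma. Qed.

Lemma coord_indep (E : coord -> set Omega) :
  (forall k, <<s coord_sigma k >> (E k)) ->
  (P (\bigcap_(k in setT) E k) = \prod_k P (E k))%E.
Proof.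
move=> sE; have {}sE k : coord_sigma k (E k) by rewrite -coord_sigmaE.
have [Bt mBt et] := sE (inl true); have [BU mBU eU] := sE (inl false).
have /choice[BZ HZ] : forall i, exists B, measurable B /\ Z i @^-1` B = E (inr i).
  by move=> i; have [B ? ?] := sE (inr i); exists B.
have [_ _ _ /(_ Bt BU BZ mBt mBU (fun i => (HZ i).1))] := real.
rewrite big_sumType/= big_bool/= -et -eU.
under [in X in _ -> X]eq_bigr do rewrite -(HZ _).2.
move=> <-.
  congr (P _); apply/seteqP; split => t /=.
  - move=> H; split; first split.
    + by have := H (inl true) I; rewrite -et.
    + by have := H (inl false) I; rewrite -eU.
    + by move=> i _; have := H (inr i) I; rewrite -(HZ i).2.
  - case=> -[ht hU] hZ [[]|i] _; [by rewrite -et|by rewrite -eU|].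
    by rewrite -(HZ i).2; exact: hZ.
Qed.

End Realization.

(** * Conditional second moments inside a realization *)

Section RealizationMoments.
Context {R : realType} {d n : nat} {dO} {Omega : measurableType dO}.
Variables (P : probability Omega R).
Context {dU} {UT : measurableType dU}.
Variables (nu : probability (d.-tuple R) R) (mu : probability (d.-tuple R * R)%type R).
Variables (th : Omega -> d.-tuple R) (Z : 'I_n.+1 -> Omega -> (d.-tuple R * R)%type)
  (U : Omega -> UT).
Hypothesis real : realization P nu mu th Z U.
Hypothesis mu2 : forall j : 'I_d, mu.-integrable setT (fun z => ((tnth z.1 j) ^+ 2)%:E).

Let mth : measurable_fun setT th. Proof. by have [[]] := real. Qed.
Let mZ i : measurable_fun setT (Z i). Proof. by have [[]] := real. Qed.
Let mU : measurable_fun setT U. Proof. by have [[]] := real. Qed.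
Let lth B : measurable B -> P (th @^-1` B) = nu B. Proof. by have [_ + _ _] := real; apply. Qed.
Let lZ i B : measurable B -> P (Z i @^-1` B) = mu B. Proof. by have [_ _ + _] := real; apply. Qed.
Let G := coord_sigma th Z U.

Lemma measurable_input (j : 'I_d) :
  measurable_fun setT (fun z : d.-tuple R * R => tnth z.1 j).
Proof. exact: (measurableT_comp (measurable_tnth j) measurable_fst). Qed.

Lemma rintegrable_input2 (j k : 'I_d) :
  rintegrable mu (fun z => tnth z.1 j * tnth z.1 k).
Proof.
apply: (@rintegrableM _ _ _ mu (fun z => tnth z.1 j) (fun z => tnth z.1 k)); [exact: measurable_input|exact: measurable_input|exact: mu2|exact: mu2].
Qed.

Lemma rintegrable_input (j : 'I_d) : rintegrable mu (fun z => tnth z.1 j).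
Proof.
have := @rintegrableM _ _ _ mu (fun z => tnth z.1 j) (fun=> 1) (@measurable_input j) (measurable_cst _) (mu2 j).
have i1 : rintegrable mu (fun=> 1 ^+ 2) by exact: rintegrable_cst.
by move=> /(_ i1); apply: eq_integrable => // z _ /=; rewrite mulr1.
Qed.

Let one_coord (k : coord) : sub_measurable (G k) (fun=> 1 : R).
Proof. exact: (@measurable_cst _ _ (g_sigma_algebraType (G k))). Qed.

Let one_int : rintegrable P (fun=> 1). Proof. exact: rintegrable_cst. Qed.

Section Noisy.
Variable s : R.
Hypothesis s0 : 0 < s.
Hypothesis noise : @noise_cond R d mu s.
Hypothesis nu2 : forall j : 'I_d, nu.-integrable setT (fun t => ((tnth t j) ^+ 2)%:E).
Hypothesis H0 : forall v : 'I_d -> R, 0 <= \sum_j \sum_k H_of nu j k * (v j * v k).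

(** Information carried by all inputs, test input included, and by [U], with theta and the noises
    left out. The weights of any rule are measurable for it ([measurable_observed]), hence so are
    the coefficients of theta and of the noises in the prediction error. *)
Definition noise_rects (k : coord) : set (set Omega) :=
  match k with
  | inl true => [set setT]
  | inl false => preimages U
  | inr i => preimages (fst \o Z i)
  end.

Let QG k : noise_rects k `<=` <<s G k >>.
Proof.
rewrite /G coord_sigmaE; case: k => [[]|i] B //=.
- by move=> ->; exists setT; rewrite ?preimage_setT.
- move=> [B' mB <-]; exists (fst @^-1` B') => //.
  by rewrite -[_ @^-1` _]setTI; exact: measurable_fst.
Qed.

Let QI k : setI_closed (noise_rects k).
Proof.
case: k => [[]|i] A B /=.
- by move=> -> ->; rewrite setTI.
- by move=> [A' mA <-] [B' mB <-]; exists (A' `&` B') => //; exact: measurableI.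
- by move=> [A' mA <-] [B' mB <-]; exists (A' `&` B') => //; exact: measurableI.
Qed.

Let QT k : noise_rects k setT.
Proof. by case: k => [[]|i] //=; exists setT; rewrite ?preimage_setT. Qed.

Let sources := ('I_d + 'I_n.+1)%type.

(** A source (a coordinate of theta or a noise) written as a product over the blocks, with factor 1
    on the blocks that do not carry it; the boolean exponent is 0 or 1. A product of two sources is
    then again a product of one variable per block. *)
Let factor (a : sources) (k : coord) (w : Omega) : R :=
  match k with
  | inl true => if a is inl j then tnth (th w) j else 1
  | inl false => 1
  | inr i => (Z i w).2 ^+ (a == inr i)
  end.

Definition noise_source (a : sources) (w : Omega) : R :=
  match a with inl j => tnth (th w) j | inr i => (Z i w).2 end.

(** Conditional second moments of the sources. The theta block is the uncentred [H_of nu], as the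
    prior may have nonzero mean; the mixed entries vanish because the noise has conditional mean
    zero. *)
Definition source_cov (a b : sources) : R :=
  match a, b with
  | inl j, inl k => H_of nu j k
  | inr i, inr i' => if i == i' then s else 0
  | _, _ => 0
  end.

(** Conditional moments of orders 0, 1 and 2 of a noise given its input; larger orders carry the
    default [s] and do not occur. *)
Let noise_mom (c : nat) : R := if c is c'.+1 then if c' is _.+1 then s else 0 else 1.

Let moment (a b : sources) (k : coord) : R :=
  match k with
  | inl true => Rintegral nu setT (fun t => (if a is inl j then tnth t j else 1) *
                                      (if b is inl j then tnth t j else 1))
  | inl false => 1
  | inr i => noise_mom ((a == inr i) + (b == inr i))
  end.

Let factor_prod a w : \prod_k factor a k w = noise_source a w.
Proof.
rewrite big_sumType big_bool/= mulr1; case: a => [j|i] /=.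
  by rewrite big1 ?mulr1.
rewrite mul1r (bigD1 i)//= eqxx expr1 big1 ?mulr1// => i' ii'.
by rewrite (_ : (_ == _) = false)//; apply/negbTE; apply: contra ii' => /eqP[->].
Qed.

Let moment_prod a b : \prod_k moment a b k = source_cov a b.
Proof.
rewrite big_sumType big_bool/= mulr1; case: a b => [j|i] [k|i'] /=.
- by rewrite big1 ?mulr1// mxE.
- by rewrite (bigD1 i')//= eqxx mul0r mulr0.
- by rewrite (bigD1 i)//= eqxx mul0r mulr0.
- rewrite mulr1 Rintegral_cstT mul1r.
  have E (x y : 'I_n.+1) : ((inr x : sources) == inr y) = (x == y).
    by apply/eqP/eqP => [[]|->].
  rewrite (bigD1 i)//= !E eqxx; case: (eqVneq i i') => [<-|ii'].
    rewrite big1 ?mulr1// => x xi.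
    by rewrite !E eq_sym (negbTE xi).
  by rewrite mul0r.
Qed.

Let theta_mul (a b : sources) :
  rintegrable nu (fun t => (if a is inl j then tnth t j else 1) *
                          (if b is inl j then tnth t j else 1)).
Proof.
have mt (a' : sources) : measurable_fun setT (fun t : d.-tuple R => if a' is inl j then tnth t j else 1).
  by case: a' => [j|_] //; exact: measurable_tnth.
apply: (@rintegrableM _ _ _ nu (fun t : d.-tuple R => if a is inl j then tnth t j else 1)) => //.
  by case: a => [j|_]; [exact: nu2|rewrite expr1n; exact: rintegrable_cst].
by case: b => [j|_]; [exact: nu2|rewrite expr1n; exact: rintegrable_cst].
Qed.

Lemma rintegrable_noise_exp (c : nat) : (c <= 2)%N -> rintegrable mu (fun z => z.2 ^+ c).
Proof.
have [i2 _] := noise.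
case: c => [|[|[|//]]] _.
- under eq_fun do rewrite expr0; exact: rintegrable_cst.
- have i1 : rintegrable mu (fun=> 1 ^+ 2) by exact: rintegrable_cst.
  have := @rintegrableM _ _ _ mu snd (fun=> 1) (measurable_snd) (measurable_cst _) i2 i1.
  by apply: eq_integrable => // z _ /=; rewrite mulr1.
- exact: i2.
Qed.

Lemma Rintegral_noise_exp (c : nat) (B : set (d.-tuple R)) : (c <= 2)%N -> measurable B ->
  Rintegral mu (fst @^-1` B) (fun z => z.2 ^+ c) = noise_mom c * fine (mu (fst @^-1` B)).
Proof.
move=> c2 mB; have [_ /(_ B mB)[e1 e2]] := noise.
have mfB : measurable (fst @^-1` B : set (d.-tuple R * R)).
  by rewrite -[_ @^-1` _]setTI; exact: measurable_fst.
case: c c2 => [|[|[|//]]] _ /=.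
- under eq_Rintegral do rewrite expr0.
  by rewrite Rintegral_cst.
- by rewrite /Rintegral e1 mul0r.
- by rewrite /Rintegral e2 fineM//; exact: fin_num_measure.
Qed.

Lemma source_cov_ge0 (v : sources -> R) :
  0 <= \sum_a \sum_b source_cov a b * (v a * v b).
Proof.
rewrite big_sumType/=; apply: addr_ge0.
  apply: le_trans (H0 (fun j => v (inl j))) _; apply: ler_sum => j _.
  by rewrite big_sumType/= [X in _ + X]big1 ?addr0// => i _; rewrite mul0r.
apply: sumr_ge0 => i _; rewrite big_sumType/= big1 ?add0r; last first.
  by move=> j _; rewrite mul0r.
apply: sumr_ge0 => i' _; case: eqVneq => [->|]; rewrite ?mul0r//.
by rewrite mulr_ge0 ?(ltW s0)// -expr2 sqr_ge0.
Qed.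

Lemma rects_coordinate {dV} {TV : measurableType dV} (k : coord) (V : Omega -> TV) :
  preimages V `<=` noise_rects k ->
  @measurable_fun _ _ (g_sigma_algebraType (rects noise_rects)) TV setT V.
Proof.
move=> VQ _ B mB; rewrite setTI; apply: sub_sigma_algebra.
exists (fun k' => if k' == k then V @^-1` B else setT).
  by move=> k' /=; case: eqP => [->|_]; [apply: VQ; exists B|exact: QT].
apply/seteqP; split => t /=; first by move=> /(_ k I); rewrite eqxx.
by move=> Vt k' _; case: eqP.
Qed.

(** The coefficients act as constants under the conditioning. On a rectangle, theta contributes its
    unconditional moment and each pair the moment of its noise over an event of its own input, which
    [noise_cond] supplies. *)
Lemma noisy_second_moment (c : sources -> Omega -> R) :
  (forall a, sub_measurable (rects noise_rects) (c a)) ->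
  (\int[P]_w ((\sum_a c a w * noise_source a w) ^+ 2)%:E =
   \int[P]_w (\sum_a \sum_b source_cov a b * (c a w * c b w))%:E)%E.
Proof.
move=> mc.
have GM := coord_sigma_measurable real.
have sf a b k : sub_measurable (G k) (fun w => factor a k w * factor b k w).
  case: k => [[]|i] /=.
  - have := @sub_measurable_preimages _ _ _ _ R th _ (rintegrable_measurable (theta_mul a b)).
    by [].
  - exact: (sub_measurableM (@one_coord (inl false)) (@one_coord (inl false))).
  - under eq_fun do rewrite -exprD.
    have := @sub_measurable_preimages _ _ _ _ R (Z i) (fun z => z.2 ^+ ((a == inr i) + (b == inr i))).
    apply; apply: (@measurable_funX _ _ _ setT (@snd (d.-tuple R) R)).
    exact: measurable_snd.
have lec (a b : sources) i : ((a == inr i) + (b == inr i) <= 2)%N.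
  by case: (_ == _); case: (_ == _).
have fi a b k : rintegrable P (fun w => factor a k w * factor b k w).
  case: k => [[]|i] /=.
  - by have := rintegrable_law mth lth (theta_mul a b).
  - by under eq_fun do rewrite mulr1; exact: one_int.
  - under eq_fun do rewrite -exprD.
    by have := rintegrable_law (mZ i) (@lZ i) (rintegrable_noise_exp (lec a b i)).
have prodE a b w : noise_source a w * noise_source b w = \prod_k (factor a k w * factor b k w).
  by rewrite big_split/= !factor_prod.
have ind := coord_indep real.
apply: (@cond_second_moment _ _ _ P (rects noise_rects)) => //.
- exact: rects_measurable QG.
- exact: rects_setI.
- exact: rects_setT.
- case=> [j|i] /=.
    exact: (measurableT_comp (measurable_tnth j) mth).
  exact: (measurableT_comp measurable_snd (mZ i)).
- move=> a b; have [+ _] := Rintegral_prod_indep GM ind (sf a b) (fi a b).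
  by apply: eq_integrable => // w _ /=; rewrite prodE.
- move=> a b B rB; rewrite -moment_prod.
  rewrite -(Rintegral_rects GM ind QG (sf a b) (fi a b) _ rB).
    by apply: eq_Rintegral => w _; exact: prodE.
  move=> [[]|i] E /=.
  + move=> ->; rewrite fine_probability_setT mulr1.
    by have := Rintegral_law mth lth measurableT (theta_mul a b); rewrite preimage_setT.
  + move=> QE; under eq_Rintegral do rewrite mulr1.
    rewrite Rintegral_cst//.
    by apply: (GM (inl false)); apply: (@QG (inl false)).
  + move=> [B' mB' <-]; under eq_Rintegral do rewrite -exprD.
    have mfB : measurable (fst @^-1` B' : set (d.-tuple R * R)).
      by rewrite -[_ @^-1` _]setTI; exact: measurable_fst.
    have := Rintegral_law (mZ i) (@lZ i) mfB (rintegrable_noise_exp (lec a b i)).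
    by rewrite Rintegral_noise_exp// -(lZ i).
- exact: source_cov_ge0.
Qed.

End Noisy.

Lemma Sigma_ge0 (v : 'I_d -> R) :
  0 <= \sum_j \sum_k Sigma_of mu j k * (v j * v k).
Proof.
have ijk j k : rintegrable mu (fun z => v j * v k * (tnth z.1 j * tnth z.1 k)).
  by apply: rintegrableZ; exact: rintegrable_input2.
rewrite (_ : \sum_j _ = Rintegral mu setT (fun z : d.-tuple R * R => (\sum_j v j * tnth z.1 j) ^+ 2)).
  by apply: Rintegral_ge0 => z _; exact: sqr_ge0.
rewrite [RHS](@eq_Rintegral _ _ _ _ _
    (fun z : d.-tuple R * R => \sum_j \sum_k v j * v k * (tnth z.1 j * tnth z.1 k))).
  rewrite Rintegral_sum; last by move=> j _; exact: rintegrable_sum.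
  apply: eq_bigr => j _; rewrite Rintegral_sum//; apply: eq_bigr => k _.
  rewrite (RintegralZl _ measurableT (rintegrable_input2 j k)) mulrC.
  by rewrite [Sigma_of mu j k]mxE.
move=> z _; rewrite expr2 mulr_suml; apply: eq_bigr => j _.
by rewrite mulr_sumr; apply: eq_bigr => k _; ring.
Qed.

(** Every block other than the two pairs gets the factor 1. This evaluates the off-diagonal terms in
    the mean of the squared Gram matrix. *)
Lemma pair_independent (i i' : 'I_n.+1) (f g : d.-tuple R * R -> R) : i != i' ->
  rintegrable mu f -> rintegrable mu g ->
  rintegrable P (fun w => f (Z i w) * g (Z i' w)) /\
  Rintegral P setT (fun w => f (Z i w) * g (Z i' w)) =
  Rintegral mu setT f * Rintegral mu setT g.
Proof.
move=> ii' fi gi.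
pose u (k : coord) (w : Omega) : R := match k with
  | inl _ => 1
  | inr j => if j == i then f (Z i w) else if j == i' then g (Z i' w) else 1 end.
have uE w : f (Z i w) * g (Z i' w) = \prod_k u k w.
  rewrite big_sumType big1//= mul1r (bigD1 i)//= eqxx; congr (_ * _).
  rewrite (bigD1 i') 1?eq_sym//=  (negbTE ii') eqxx big1 ?mulr1// => j /andP[ji ji'].
  by rewrite (negbTE ji) (negbTE ji').
have [||iu eu] := @Rintegral_prod_indep _ _ _ P _ _ (coord_sigma_measurable real) (coord_indep real) u.
- case=> [b|j]; first by exact: (@one_coord (inl b)).
  rewrite /u; case: eqVneq => [->|_].
    exact: (@sub_measurable_preimages _ _ _ _ R (Z i) f (rintegrable_measurable fi)).
  case: eqVneq => [->|_]; last exact: (@one_coord (inr j)).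
  exact: (@sub_measurable_preimages _ _ _ _ R (Z i') g (rintegrable_measurable gi)).
- case=> [b|j]; first exact: one_int.
  rewrite /u; case: eqVneq => [_|_]; first exact: (rintegrable_law (mZ i) (@lZ i) fi).
  case: eqVneq => [_|_]; last exact: one_int.
  exact: (rintegrable_law (mZ i') (@lZ i') gi).
split; first by move: iu; apply: eq_integrable => // w _ /=; rewrite uE.
rewrite (@eq_Rintegral _ _ _ _ _ (fun w => \prod_k u k w)); last by move=> w _; exact: uE.
rewrite eu big_sumType big1/= ?mul1r; last first.
  by move=> b _; exact: Rintegral_cstT.
rewrite (bigD1 i)//= (bigD1 i') 1?eq_sym//= big1 ?mulr1; last first.
  by move=> j /andP[ji ji']; rewrite /u (negbTE ji) (negbTE ji'); exact: Rintegral_cstT.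
rewrite /u eqxx [i' == i]eq_sym (negbTE ii') eqxx.
have := Rintegral_law (mZ i) (@lZ i) measurableT fi.
have := Rintegral_law (mZ i') (@lZ i') measurableT gi.
by rewrite !preimage_setT => <- <-.
Qed.

(** Information carried by the training inputs alone: the test input can then be averaged out of a
    quadratic expression whose coefficients are built from the training inputs. *)
Definition test_rects (k : coord) : set (set Omega) :=
  match k with
  | inl _ => [set setT]
  | inr i => if i == ord0 then [set setT] else preimages (fst \o Z i)
  end.

Let tQG k : test_rects k `<=` <<s G k >>.
Proof.
rewrite /G coord_sigmaE; case: k => [[]|i] B /=; rewrite /preimages /=.
- by move=> ->; exists setT; rewrite ?preimage_setT.
- by move=> ->; exists setT; rewrite ?preimage_setT.
case: eqP => [_ ->|_ [B' mB <-]]; first by exists setT; rewrite ?preimage_setT.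
exists (fst @^-1` B') => //.
by rewrite -[_ @^-1` _]setTI; exact: measurable_fst.
Qed.

Let tQI k : setI_closed (test_rects k).
Proof.
case: k => [_|i] A B /=; first by move=> -> ->; rewrite setTI.
case: eqP => [_ -> ->|_ [A' mA <-] [B' mB <-]]; first by rewrite setTI.
by exists (A' `&` B') => //; exact: measurableI.
Qed.

Let tQT k : test_rects k setT.
Proof.
case: k => [_|i] //=; case: eqP => //= _.
by exists setT; rewrite ?preimage_setT.
Qed.

Lemma measurable_train_inputs :
  @measurable_fun _ _ (g_sigma_algebraType (rects test_rects)) _ setT (train_inputs Z).
Proof.
apply/(@measurable_fun_tnthP _ _ (g_sigma_algebraType (rects test_rects))) => i.
move=> _ B mB; rewrite setTI; apply: sub_sigma_algebra.
exists (fun k => if k == inr (lift ord0 i) then (fst \o Z (lift ord0 i)) @^-1` B else setT).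
  move=> k /=; case: eqP => [->|_]; last exact: tQT.
  rewrite /test_rects; case: eqP => [e|_]; last by exists B.
  by have := neq_lift ord0 i; rewrite e eqxx.
apply/seteqP; split => w /=.
  by move=> /(_ (inr (lift ord0 i)) I); rewrite eqxx /= tnth_mktuple.
by rewrite tnth_mktuple => Bw k _; case: eqP.
Qed.

Lemma test_second_moment (c : 'I_d -> Omega -> R) :
  (forall a, sub_measurable (rects test_rects) (c a)) ->
  (\int[P]_w ((\sum_a c a w * tnth (Z ord0 w).1 a) ^+ 2)%:E =
   \int[P]_w (\sum_a \sum_b Sigma_of mu a b * (c a w * c b w))%:E)%E.
Proof.
move=> mc.
have GM := coord_sigma_measurable real.
have ind := coord_indep real.
pose u (a b : 'I_d) (k : coord) (w : Omega) : R :=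
  if k == inr (ord0 : 'I_n.+1) then tnth (Z ord0 w).1 a * tnth (Z ord0 w).1 b else 1.
have sf a b k : sub_measurable (G k) (u a b k).
  rewrite /u; case: (eqVneq k (inr (ord0 : 'I_n.+1))) => [->|_]; last exact: (@one_coord k).
  exact: (@sub_measurable_preimages _ _ _ _ R (Z ord0) _
    (rintegrable_measurable (rintegrable_input2 a b))).
have fi a b k : rintegrable P (u a b k).
  rewrite /u; case: (eqVneq k (inr (ord0 : 'I_n.+1))) => [_|_]; last exact: one_int.
  exact: (rintegrable_law (mZ ord0) (@lZ ord0) (rintegrable_input2 a b)).
have prodE a b w : tnth (Z ord0 w).1 a * tnth (Z ord0 w).1 b = \prod_k u a b k w.
  by rewrite (bigD1 (inr (ord0 : 'I_n.+1) : coord))//= /u eqxx big1 ?mulr1// => k /negbTE ->.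
apply: (@cond_second_moment _ _ _ P (rects test_rects)
  (rects_measurable GM tQG) (rects_setI tQI) (rects_setT tQT) 'I_d
  (fun a w => tnth (Z ord0 w).1 a)) => //.
- by move=> a; exact: (measurableT_comp (measurable_input a) (mZ ord0)).
- move=> a b; have [+ _] := Rintegral_prod_indep GM ind (sf a b) (fi a b).
  by apply: eq_integrable => // w _ /=; rewrite prodE.
- move=> a b B rB.
  rewrite (@eq_Rintegral _ _ _ _ _ (fun w => \prod_k u a b k w)); last first.
    by move=> w _; exact: prodE.
  rewrite (@Rintegral_rects _ _ _ P _ _ GM ind _ tQG (u a b)
    (fun k => if k == inr (ord0 : 'I_n.+1) then Sigma_of mu a b else 1))//.
    by rewrite (bigD1 (inr (ord0 : 'I_n.+1) : coord))//= ?eqxx big1 ?mulr1// => k /negbTE ->.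
  move=> k E QE; rewrite /u; case: (eqVneq k (inr (ord0 : 'I_n.+1))) QE => [->|k0 QE].
    move=> /= ->; rewrite fine_probability_setT mulr1 mxE.
    have := Rintegral_law (mZ ord0) (@lZ ord0) measurableT (rintegrable_input2 a b).
    by rewrite preimage_setT.
  by rewrite Rintegral_cst//; apply: (GM k); exact: tQG.
- exact: Sigma_ge0.
Qed.

End RealizationMoments.

(** * Existence of a realization *)

Lemma iid_exists {dT} {T : measurableType dT} {R : realType} (m : probability T R) (k : nat) :
  exists (dO : measure_display) (Omega : measurableType dO) (P : probability Omega R)
    (Z : 'I_k -> Omega -> T), (forall i, measurable_fun setT (Z i)) /\
    forall B : 'I_k -> set T, (forall i, measurable (B i)) ->
      (P (\bigcap_(i in setT) (Z i @^-1` B i)) = \prod_(i < k) m (B i))%E.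
Proof.
elim: k => [|k IH].
  (* With no variable to define, any probability space serves. *)
  exists dT, T, m, (fun _ t => t); split; first by case.
  move=> B mB; rewrite big_ord0 (_ : \bigcap_(i in _) _ = setT) ?probability_setT//.
  by apply/seteqP; split => // t _ [].
have [dO [Om [P [Z [mZ PZ]]]]] := IH.
exists _, (Om * T)%type, (P \x m)%E,
  (fun i w => if unlift ord0 i is Some j then Z j w.1 else w.2); split.
  move=> i; case: unliftP => [j _|_]; last exact: measurable_snd.
  exact: (measurableT_comp (mZ j) measurable_fst).
move=> B mB; rewrite big_ord_recl.
rewrite -(PZ (fun j => B (lift ord0 j)))// muleC -product_measure1E//; last first.
  apply: fin_bigcap_measurable => // i _.
  by rewrite -[_ @^-1` _]setTI; exact: mZ.
congr (_ _); apply/seteqP; split => -[w t] /=.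
  move=> H; split; last by have := H ord0 I; rewrite /= unlift_none.
  by move=> j _; have := H (lift ord0 j) I; rewrite /= liftK.
by case=> H1 H2 i _ /=; case: unliftP => [j ->|->]//=; exact: (H1 j I).
Qed.

(** Without a realization [Ebar0] would be an infimum over the empty set, that is [+oo]. The product
    of [nu] with an i.i.d. sample, together with a constant [U], provides one. *)
Lemma realization_exists {R : realType} {d n : nat}
    (mu : probability (d.-tuple R * R)%type R) (nu : probability (d.-tuple R) R) :
  exists (dO : measure_display) (Omega : measurableType dO) (P : probability Omega R)
    (th : Omega -> d.-tuple R) (Z : 'I_n.+1 -> Omega -> (d.-tuple R * R)%type)
    (U : Omega -> unit), realization P nu mu th Z U.
Proof.
have [dO [Om [P [Z [mZ PZ]]]]] := iid_exists mu n.+1.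
have PZ1 i B : measurable B -> P (Z i @^-1` B) = mu B.
  move=> mB; have := PZ (fun j => if j == i then B else setT).
  rewrite (bigD1 i)//= eqxx big1 ?mule1; last first.
    by move=> j /negbTE ->; exact: probability_setT.
  move=> <-; last by move=> j; case: eqP.
  congr (P _); apply/seteqP; split => w /=.
    by move=> Bw j _; case: eqP => [->|].
  by move=> /(_ i I); rewrite eqxx.
have mpre i B : measurable B -> measurable (Z i @^-1` B).
  by move=> mB; rewrite -[_ @^-1` _]setTI; exact: mZ.
exists _, (d.-tuple R * Om)%type, (nu \x P)%E, fst, (fun i w => Z i w.2), (fun=> tt).
have preS (B : set Om) : snd @^-1` B = [set: d.-tuple R] `*` B.
  by apply/seteqP; split => -[x y] //= [].
have preF (B : set (d.-tuple R)) : fst @^-1` B = B `*` [set: Om].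
  by apply/seteqP; split => -[x y] //= [].
have lf B : measurable B -> (nu \x P)%E (fst @^-1` B) = nu B.
  by move=> mB; rewrite preF [LHS]product_measure1E// [X in (_ * X)%E]probability_setT mule1.
have ls B : measurable B -> (nu \x P)%E (snd @^-1` B) = P B.
  by move=> mB; rewrite preS [LHS]product_measure1E// [X in (X * _)%E]probability_setT mul1e.
split => //.
- split=> // i; exact: (measurableT_comp (mZ i) measurable_snd).
- by move=> i B mB; rewrite [LHS](ls (Z i @^-1` B)) ?PZ1//; exact: mpre.
move=> Bt BU BZ mBt mBU mBZ.
have mI : measurable (\bigcap_(i in setT) (Z i @^-1` BZ i)).
  by apply: fin_bigcap_measurable => // i _; exact: mpre.
rewrite [X in (X * _ * _)%E]lf//.
rewrite (eq_bigr (fun i => mu (BZ i))); last first.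
  by move=> i _; rewrite [LHS](ls (Z i @^-1` BZ i)) ?PZ1//; exact: mpre.
rewrite -PZ//; have [Utt|Utt] := pselect (BU tt).
  rewrite (_ : _ @^-1` BU = [set: d.-tuple R * Om]); last by apply/seteqP; split.
  rewrite [X in (_ * X * _)%E]probability_setT mule1 setIT.
  rewrite -[RHS]product_measure1E//.
rewrite (_ : _ @^-1` BU = set0 :> set (d.-tuple R * Om)); last by apply/seteqP; split.
by rewrite setI0 set0I !measure0 mule0 mul0e.
Qed.

(** * Ridge regression and trace inequalities *)

Section MatrixFacts.
Context {R : realType} {d : nat}.
Implicit Types (S W B M : 'M[R]_d).

Definition quad_ge0 W := forall v : 'cV[R]_d, 0 <= quad W v.

Definition dotc {m} (u v : 'cV[R]_m) : R := (u^T *m v) 0 0.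

Lemma dotcE m (u v : 'cV[R]_m) : dotc u v = \sum_i u i 0 * v i 0.
Proof. by rewrite /dotc mxE; apply: eq_bigr => i _; rewrite mxE. Qed.

Lemma dotcC m (u v : 'cV[R]_m) : dotc u v = dotc v u.
Proof. by rewrite !dotcE; apply: eq_bigr => i _; rewrite mulrC. Qed.

Lemma dotcDr m (u v w : 'cV[R]_m) : dotc u (v + w) = dotc u v + dotc u w.
Proof. by rewrite /dotc mulmxDr mxE. Qed.

Lemma dotcNr m (u v : 'cV[R]_m) : dotc u (- v) = - dotc u v.
Proof. by rewrite /dotc mulmxN mxE. Qed.

Lemma dotcZr m (u v : 'cV[R]_m) k : dotc u (k *: v) = k * dotc u v.
Proof. by rewrite /dotc -scalemxAr mxE. Qed.

Lemma dotc_sqD m (u v : 'cV[R]_m) :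
  dotc (u + v) (u + v) = dotc u u + 2 * dotc u v + dotc v v.
Proof.
rewrite dotcDr [dotc _ u]dotcC [dotc _ v]dotcC !dotcDr [dotc v u]dotcC; ring.
Qed.

Lemma dotc_mulr m p (A : 'M[R]_(m, p)) u v : dotc u (A *m v) = dotc (A^T *m u) v.
Proof. by rewrite /dotc trmx_mul trmxK mulmxA. Qed.

Lemma dotc_ge0 m (v : 'cV[R]_m) : 0 <= dotc v v.
Proof. by rewrite dotcE sumr_ge0// => i _; rewrite -expr2 sqr_ge0. Qed.

Lemma dotc_eq0 m (v : 'cV[R]_m) : dotc v v = 0 -> v = 0.
Proof.
rewrite dotcE => /eqP; rewrite psumr_eq0; last by move=> i _; rewrite -expr2 sqr_ge0.
move=> /allP H; apply/matrixP => i j; rewrite (ord1 j) mxE.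
by have := H i (mem_index_enum i); rewrite /= mulf_eq0 orbb => /eqP.
Qed.

Lemma sqnorm_dotc (v : 'cV[R]_d) : sqnorm v = dotc v v.
Proof. by rewrite dotcE; apply: eq_bigr => i _; rewrite expr2. Qed.

Lemma quad_dotc W (v : 'cV[R]_d) : quad W v = dotc v (W *m v).
Proof. by rewrite /quad /dotc mulmxA. Qed.

Lemma quad_congr W (C : 'M[R]_d) v : quad (C^T *m W *m C) v = quad W (C *m v).
Proof. by rewrite /quad trmx_mul !mulmxA. Qed.

Lemma quad_ge0D W W' : quad_ge0 W -> quad_ge0 W' -> quad_ge0 (W + W').
Proof. by move=> H H' v; rewrite /quad mulmxDr mulmxDl mxE addr_ge0//; [exact: H|exact: H']. Qed.

Lemma quad_ge0Z k W : 0 <= k -> quad_ge0 W -> quad_ge0 (k *: W).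
Proof. by move=> k0 H v; rewrite /quad -scalemxAr -scalemxAl mxE mulr_ge0//; exact: H. Qed.

Lemma quad_ge0_congr W (C : 'M[R]_d) : quad_ge0 W -> quad_ge0 (C^T *m W *m C).
Proof. by move=> H v; rewrite quad_congr; exact: H. Qed.

Lemma quad_ge0_gram m (A : 'M[R]_(d, m)) : quad_ge0 (A *m A^T).
Proof.
move=> v; rewrite quad_dotc -mulmxA dotc_mulr; exact: dotc_ge0.
Qed.

Lemma trace_quad_ge0 W : quad_ge0 W -> 0 <= \tr W.
Proof.
move=> H; apply: sumr_ge0 => i _; have := H (delta_mx i 0).
by rewrite /quad trmx_delta -rowE -colE !mxE.
Qed.

(** A row vector v in the left kernel satisfies v W v^T + s |v|^2 = 0 with both terms nonnegative,
    so it vanishes. *)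
Lemma add_scalar_unit W s : 0 < s -> quad_ge0 W -> W + s%:M \in unitmx.
Proof.
move=> s0 H; rewrite -row_free_unit; apply/inj_row_free => v vW0.
have : dotc v^T ((W + s%:M)^T *m v^T) = 0.
  by rewrite -trmx_mul vW0 trmx0 /dotc mulmx0 mxE.
rewrite linearD/= tr_scalar_mx mulmxDl dotcDr mul_scalar_mx dotcZr.
have e : dotc v^T (W^T *m v^T) = quad W v^T.
  by rewrite dotc_mulr trmxK dotcC quad_dotc.
rewrite e => E; have := dotc_ge0 v^T; have := H v^T => q0 n0.
have : dotc v^T v^T = 0.
  apply/eqP; rewrite eq_le n0 andbT -(pmulr_rle0 _ s0); lra.
by move=> /dotc_eq0/(congr1 trmx); rewrite trmxK trmx0.
Qed.

Lemma invmx_uniq (A B : 'M[R]_d) : A *m B = 1%:M -> invmx A = B.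
Proof.
move=> AB; have [uA _] := mulmx1_unit AB.
by rewrite -[invmx A]mulmx1 -AB mulKmx.
Qed.

End MatrixFacts.

(** * Ridge weights for fixed inputs *)

Section Ridge.
Context {R : realType} {d n : nat}.
Variables (X : 'M[R]_(d, n)) (s : R).
Hypothesis s0 : 0 < s.
Let S := X *m X^T.
Let N := S + s%:M.
Let M := invmx N.

Lemma ridge_unit : N \in unitmx.
Proof. by apply: add_scalar_unit => //; exact: quad_ge0_gram. Qed.

Lemma ridge_inv_sym : M^T = M.
Proof.
by rewrite /M trmx_inv /N linearD/= tr_scalar_mx /S trmx_mul trmxK.
Qed.

Lemma ridge_gram_sym : S^T = S. Proof. by rewrite /S trmx_mul trmxK. Qed.

Let NM : N *m M = 1%:M. Proof. by rewrite mulmxV// ridge_unit. Qed.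
Let MN : M *m N = 1%:M. Proof. by rewrite mulVmx// ridge_unit. Qed.

Lemma ridge_gram_comm : S *m N = N *m S.
Proof. by rewrite /N mulmxDr mulmxDl mul_mx_scalar mul_scalar_mx. Qed.

Lemma ridge_comm : S *m M = M *m S.
Proof.
rewrite -[LHS]mul1mx -MN -(mulmxA M N) (mulmxA N S M) -ridge_gram_comm.
by rewrite -(mulmxA S N M) NM mulmx1.
Qed.

(** Completing the square: moving from [l0] to [l0 + e] raises the objective by exactly |X e|^2 + s
    |e|^2. *)
Lemma ridge_optimal (x : 'cV[R]_d) (l l0 : 'cV[R]_n) : l0 = X^T *m M *m x ->
  sqnorm (x - X *m l0) + s * dotc l0 l0 <= sqnorm (x - X *m l) + s * dotc l l.
Proof.
move=> l0E; pose r := x - X *m l0; pose e := l - l0.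
(* Normal equations, which cancel the term linear in [e]. The residual equals [s *: (M *m x)]
   because [N - S] is the scalar matrix [s]. *)
have Xr : X^T *m r = s *: l0.
  have -> : r = s *: (M *m x).
    rewrite /r l0E !mulmxA -[X in X - _]mul1mx -NM /N !mulmxDl.
    by rewrite mul_scalar_mx addrC addKr scalemxAl.
  by rewrite -scalemxAr l0E mulmxA.
have -> : l = l0 + e by rewrite /e addrC subrK.
have -> : x - X *m (l0 + e) = r + - (X *m e).
  by rewrite /r mulmxDr opprD addrA.
rewrite !sqnorm_dotc -/r; clearbody r e; rewrite !dotc_sqD !dotcNr (dotc_mulr X r e) Xr [dotc (s *: l0) e]dotcC.
rewrite dotcZr [dotc e l0]dotcC [dotc (- (X *m e)) _]dotcC dotcNr.
have h1 := dotc_ge0 (X *m e); have h2 := dotc_ge0 e.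
have h3 := mulr_ge0 (ltW s0) h2; nra.
Qed.

End Ridge.

(** * Trace inequalities around the resolvents of Sigma_H *)

Section TraceBounds.
Context {R : realType} {d : nat}.
Variable Sg : 'M[R]_d.
(** Duality of the positive cone in the only form needed. It replaces a square root of [Sg], and
    holds at once for a second-moment matrix ([white_cov_dual]). *)
Hypothesis Sg_dual : forall W : 'M[R]_d, quad_ge0 W -> 0 <= \tr (Sg *m W).
Hypothesis SgT : Sg^T = Sg.
Hypothesis Sg0 : quad_ge0 Sg.

Let resolvent_spec c : 0 < c ->
  [/\ (Sg + c%:M) *m invmx (Sg + c%:M) = 1%:M,
      invmx (Sg + c%:M) *m (Sg + c%:M) = 1%:M,
      (invmx (Sg + c%:M))^T = invmx (Sg + c%:M) &
      Sg *m invmx (Sg + c%:M) = invmx (Sg + c%:M) *m Sg].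
Proof.
move=> c0; have u := add_scalar_unit c0 Sg0.
have e1 := mulmxV u; have e2 := mulVmx u; split => //.
  by rewrite trmx_inv linearD/= tr_scalar_mx SgT.
rewrite -[LHS]mul1mx -{1}e2 -mulmxA (mulmxA (Sg + _)).
have -> : (Sg + c%:M) *m Sg = Sg *m (Sg + c%:M).
  by rewrite mulmxDr mulmxDl mul_mx_scalar mul_scalar_mx.
by rewrite -(mulmxA Sg) e1 mulmx1.
Qed.

Lemma resolvent_quad_ge0 c : 0 < c -> quad_ge0 (invmx (Sg + c%:M)).
Proof.
move=> c0; have [e1 e2 eT _] := resolvent_spec c0.
set C := invmx _ in e1 e2 eT *.
rewrite (_ : C = C^T *m (Sg + c%:M) *m C); last by rewrite eT -mulmxA e1 mulmx1.
apply: quad_ge0_congr; apply: quad_ge0D => // v.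
rewrite quad_dotc mul_scalar_mx dotcZr mulr_ge0 ?dotc_ge0//; exact: ltW.
Qed.

Lemma df2E lam : 0 < lam ->
  df2 Sg lam = \tr (Sg *m invmx (Sg + lam%:M) *m Sg *m invmx (Sg + lam%:M)).
Proof.
move=> l0; have [e1 e2 _ cm] := resolvent_spec l0.
rewrite /df2 (@invmx_uniq _ _ _ (invmx (Sg + lam%:M) *m invmx (Sg + lam%:M))).
  by rewrite !mulmxA -[Sg *m _ *m Sg]mulmxA -cm !mulmxA.
by rewrite -mulmxA (mulmxA (Sg + _) (invmx _)) e1 mul1mx e1.
Qed.

(** On an eigenvalue t >= 0 this is k (t + lam) >= t + k lam, squared. The proof stays with
    matrices: expanding both copies of [k *: D] leaves the wanted trace plus two traces against
    congruences of resolvents, nonnegative by duality. *)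
Lemma df2_scale lam k : 0 < lam -> 1 <= k ->
  k ^- 2 * df2 Sg lam <= df2 Sg (k * lam).
Proof.
move=> l0 k1; have k0 : 0 < k by lra.
have kl0 : 0 < k * lam by rewrite mulr_gt0.
rewrite !df2E//.
have [a1 a2 aT ac] := resolvent_spec l0; have [b1 b2 bT bc] := resolvent_spec kl0.
have C0 := resolvent_quad_ge0 l0; have C1 := resolvent_quad_ge0 kl0.
set C := invmx (Sg + lam%:M) in a1 a2 aT ac C0 *.
set D := invmx (Sg + (k * lam)%:M) in b1 b2 bT bc C1 *.
(* Resolvent identity, from k (Sg + lam) = (Sg + k lam) + (k - 1) Sg multiplied by [D] on the left
   and [C] on the right. *)
have kD : k *: D = C + (k - 1) *: (D *m Sg *m C).
  have e : k *: (Sg + lam%:M) = (Sg + (k * lam)%:M) + (k - 1) *: Sg.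
    by rewrite scalerDr scale_scalar_mx scalerBl scale1r; apply/matrixP => i j; rewrite !mxE; ring.
  rewrite -[k *: D]mulmx1 -a1 -scalemxAl mulmxA scalemxAl scalemxAr e.
  by rewrite mulmxDr b2 mulmxDl mul1mx -scalemxAr -scalemxAl.
rewrite mulrC ler_pdivrMr ?exprn_gt0// mulrC.
have -> : k ^+ 2 * \tr (Sg *m D *m Sg *m D) = \tr (Sg *m (k *: D) *m Sg *m (k *: D)).
  by rewrite -!scalemxAr -!scalemxAl !mxtraceZ mulrA expr2.
pose W1 := D *m Sg *m C *m Sg *m (k *: D).
pose W2 := C *m Sg *m D *m Sg *m C.
have -> : \tr (Sg *m (k *: D) *m Sg *m (k *: D)) = \tr (Sg *m C *m Sg *m C) +
    (k - 1) * (\tr (Sg *m W1) + \tr (Sg *m W2)).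
  move: kD; rewrite /W1 /W2; move: (k *: D) => Y kD.
  rewrite {1}kD mulmxDr -scalemxAr !mulmxDl -!scalemxAl mxtraceD mxtraceZ.
  rewrite [in X in X + _]kD mulmxDr -scalemxAr mxtraceD mxtraceZ !mulmxA.
  by rewrite mulrDr addrA addrAC.
rewrite lerDl mulr_ge0 ?subr_ge0// addr_ge0// Sg_dual//.
- rewrite (_ : W1 = k *: ((Sg *m D)^T *m C *m (Sg *m D))).
    by apply: quad_ge0Z; [exact: ltW|exact: quad_ge0_congr].
  by rewrite /W1 trmx_mul bT SgT !mulmxA -scalemxAr.
- rewrite (_ : W2 = (Sg *m C)^T *m D *m (Sg *m C)); first exact: quad_ge0_congr.
  by rewrite /W2 trmx_mul aT SgT !mulmxA.
Qed.

(** Two nonnegative squares around [B], both vanishing when [M = B]. The first bounds M S M below by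
    an expression linear in [S *m M]; the second bounds [S *m M] below by a polynomial in S of
    degree two. Adding the first to twice the second gives the coefficients 4, -2, -1. *)
Lemma trace_ridge_ge {n} (X : 'M[R]_(d, n)) (s : R) (B : 'M[R]_d) : 0 < s ->
  let S := X *m X^T in let M := invmx (S + s%:M) in
  B^T = B -> Sg *m B = B *m Sg ->
  (forall W, quad_ge0 W -> 0 <= \tr (B *m Sg *m W)) ->
  4 * \tr (B *m Sg *m B *m S) - 2 * \tr (B *m Sg *m B *m (S *m S + s *: S) *m B)
    - \tr (Sg *m B *m S *m B) <= \tr (Sg *m M *m S *m M).
Proof.
move=> s0 S M BT SgB phi.
have MT : M^T = M by exact: ridge_inv_sym.
have SM : S *m M = M *m S by exact: ridge_comm.
have ST : S^T = S by exact: ridge_gram_sym.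
have S0 : quad_ge0 S by exact: quad_ge0_gram.
have u : S + s%:M \in unitmx by exact: ridge_unit.
have NM : (S + s%:M) *m M = 1%:M by exact: mulmxV.
have MN : M *m (S + s%:M) = 1%:M by exact: mulVmx.
have SS0 : quad_ge0 (S *m S) by rewrite -{2}ST; exact: quad_ge0_gram.
clearbody M; clearbody S.
have SN : S *m (S + s%:M) = S *m S + s *: S by rewrite mulmxDr mul_mx_scalar.
have NS : (S + s%:M) *m S = S *m S + s *: S by rewrite mulmxDl mul_scalar_mx.
have MBT : (M - B)^T = M - B by rewrite linearB/= MT BT.
have h1 : 0 <= \tr (Sg *m ((M - B) *m S *m (M - B))).
  by apply: Sg_dual; have := quad_ge0_congr (M - B) S0; rewrite MBT.
(* [S *m M] is the congruence of S^2 + s S by [M]. *)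
have SM0 : quad_ge0 (S *m M).
  have E : M^T *m (S^T *m S + s *: S) *m M = S *m M.
    by rewrite MT ST -SN (mulmxA M) -SM -(mulmxA (S *m M)) NM mulmx1.
  rewrite -E; apply: quad_ge0_congr; apply: quad_ge0D.
    by rewrite ST.
  by apply: quad_ge0Z => //; exact: ltW.
(* The outer factors cancel [M] against [S + s] in every term except one, so a single occurrence of
   the inverse remains. *)
have h2 : 0 <= \tr (B *m Sg *m ((1%:M - B *m (S + s%:M)) *m (S *m M) *m
    (1%:M - (S + s%:M) *m B))).
  apply: phi; have := quad_ge0_congr (1%:M - (S + s%:M) *m B) SM0.
  have -> : (1%:M - (S + s%:M) *m B)^T = 1%:M - B *m (S + s%:M).
    by rewrite [LHS]linearB/= trmx_mul [(S + _)^T]linearD/= !tr_scalar_mx BT ST.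
  by [].
have e1 : (M - B) *m S *m (M - B) = M *m S *m M - B *m (S *m M) - (S *m M *m B - B *m S *m B).
  by rewrite mulmxBr !mulmxBl !mulmxA -SM.
have e2 : (1%:M - B *m (S + s%:M)) *m (S *m M) *m (1%:M - (S + s%:M) *m B) =
    S *m M - B *m S - (S *m B - B *m (S *m S + s *: S) *m B).
  have f1 : B *m (S + s%:M) *m (S *m M) = B *m S.
    by rewrite SM -mulmxA (mulmxA (S + _)) NM mul1mx.
  have f2 : S *m M *m ((S + s%:M) *m B) = S *m B.
    by rewrite -mulmxA (mulmxA M) MN mul1mx.
  by rewrite mulmxBl mul1mx f1 mulmxBr mulmx1 mulmxBl f2 mulmxA -(mulmxA B S) SN.
have t1 : \tr (Sg *m (S *m M *m B)) = \tr (B *m Sg *m (S *m M)).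
  by rewrite (mulmxA Sg (S *m M)) mxtrace_mulC !mulmxA.
have t2 : \tr (Sg *m (B *m (S *m M))) = \tr (B *m Sg *m (S *m M)).
  by rewrite (mulmxA Sg B) SgB.
have t3 : \tr (B *m Sg *m (S *m B)) = \tr (B *m Sg *m B *m S).
  by rewrite !mulmxA mxtrace_mulC !mulmxA -[B *m B *m Sg]mulmxA -[in LHS]SgB !mulmxA.
have t4 : \tr (B *m Sg *m (B *m S)) = \tr (B *m Sg *m B *m S) by rewrite mulmxA.
have linB (W W' : 'M[R]_d) : \tr (W - W') = \tr W - \tr W' by rewrite linearB.
move: h1 h2; rewrite e1 e2 !mulmxBr !linB t1 t2 t3 t4.
rewrite !mulmxA; lra.
Qed.

Section MomentBound.
Variables (n : nat) (s L2 : R).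
Hypotheses (n0 : (0 < n)%N) (s0 : 0 < s) (L20 : 0 <= L2).

Let nR0 : 0 < n%:R :> R. Proof. by rewrite ltr0n. Qed.

Lemma scaled_resolvent_exists : exists B : 'M[R]_d,
  [/\ B^T = B, Sg *m B = B *m Sg, (n%:R *: Sg + (s + L2)%:M) *m B = 1%:M &
      n%:R^-1 * df2 Sg ((s + L2) / n%:R) = n%:R * \tr (Sg *m B *m Sg *m B)].
Proof.
have lam0 : 0 < (s + L2) / n%:R.
  by rewrite divr_gt0//; have := s0; have := L20; lra.
have [e1 _ e2 e3] := resolvent_spec lam0.
exists (n%:R^-1 *: invmx (Sg + ((s + L2) / n%:R)%:M)); split.
- by rewrite linearZ/= e2.
- by rewrite -scalemxAr -scalemxAl e3.
- have -> : n%:R *: Sg + (s + L2)%:M = n%:R *: (Sg + ((s + L2) / n%:R)%:M).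
    rewrite scalerDr scale_scalar_mx mulrC -mulrA mulVf ?mulr1//.
    by rewrite lt0r_neq0.
  by rewrite -scalemxAl -scalemxAr e1 scalerA mulfV ?scale1r// lt0r_neq0.
rewrite df2E//; move: (invmx _) => C.
rewrite -!scalemxAr -!scalemxAl -?scalemxAr !mxtraceZ.
by rewrite !mulrA mulfV ?mul1r// lt0r_neq0.
Qed.

Variables (K4 B : 'M[R]_d).
Hypothesis K4_le : quad_ge0 (L2 *: Sg - K4).
Hypotheses (BT : B^T = B) (SB : Sg *m B = B *m Sg).
Hypothesis inverse : (n%:R *: Sg + (s + L2)%:M) *m B = 1%:M.

(** Inserting the inverse of [B] writes the product as n (B Sg)(Sg B) + (s + L2) B Sg B. The first
    term is handled by a congruence of [W], the second by duality for [Sg]; no square root of a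
    product of commuting matrices is taken. *)
Lemma scaled_resolvent_dual W : quad_ge0 W -> 0 <= \tr (B *m Sg *m W).
Proof.
move=> W0.
have -> : B *m Sg = n%:R *: (B *m Sg *m (Sg *m B)) + (s + L2) *: (B *m Sg *m B).
  rewrite -[LHS]mulmx1 -inverse mulmxDl mulmxDr mul_scalar_mx.
  by rewrite -scalemxAl -!scalemxAr.
rewrite mulmxDl -!scalemxAl mxtraceD !mxtraceZ addr_ge0// mulr_ge0//.
- rewrite -[B *m Sg *m (Sg *m B) *m W]mulmxA mxtrace_mulC.
  have -> : Sg *m B *m W *m (B *m Sg) = (B *m Sg)^T *m W *m (B *m Sg).
    by rewrite trmx_mul BT SgT.
  by apply: trace_quad_ge0; exact: quad_ge0_congr.
- by have := s0; have := L20; lra.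
- rewrite -!mulmxA mxtrace_mulC -!mulmxA; apply: Sg_dual.
  by rewrite mulmxA -{1}BT; exact: quad_ge0_congr.
Qed.

(** By the choice of [B], the quadratic term becomes n tr(Sg B Sg B) up to a slack of favourable
    sign, so the three terms leave 4 - 2 - 1 = 1 copy of it. *)
Lemma expected_trace_ge (S1 S2 : 'M[R]_d) :
  S1 = n%:R *: Sg -> S2 = (n%:R * (n%:R - 1)) *: (Sg *m Sg) + n%:R *: K4 ->
  n%:R * \tr (Sg *m B *m Sg *m B) <=
  4 * \tr (B *m Sg *m B *m S1) - 2 * \tr (B *m Sg *m B *m (S2 + s *: S1) *m B)
    - \tr (Sg *m B *m S1 *m B).
Proof.
move=> -> ->.
(* The slack: n Sg^2 is lost by replacing n (n - 1) with n^2, the rest by replacing the fourth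
   moment with L2 Sg. *)
pose Q := n%:R *: (Sg *m Sg) + n%:R *: (L2 *: Sg - K4).
have Q0 : quad_ge0 Q.
  apply: quad_ge0D; apply: quad_ge0Z; rewrite ?(ltW nR0)//.
  by rewrite -{2}SgT; exact: quad_ge0_gram.
have qQ : 0 <= \tr (B *m Sg *m B *m Q *m B).
  have := scaled_resolvent_dual (quad_ge0_congr B Q0).
  by rewrite BT !mulmxA.
have eS : (n%:R * (n%:R - 1)) *: (Sg *m Sg) + n%:R *: K4 + s *: (n%:R *: Sg) =
    n%:R *: (Sg *m (n%:R *: Sg + (s + L2)%:M)) - Q.
  rewrite /Q mulmxDr mul_mx_scalar -scalemxAr.
  move: (Sg *m Sg) => SS; apply/matrixP => i j; rewrite !mxE; ring.
rewrite eS; clearbody Q.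
have -> : B *m Sg *m B *m (n%:R *: (Sg *m (n%:R *: Sg + (s + L2)%:M)) - Q) *m B =
    n%:R *: (B *m Sg *m B *m Sg) - B *m Sg *m B *m Q *m B.
  rewrite mulmxBr mulmxBl; congr (_ - _).
  by rewrite -scalemxAr -scalemxAl -!mulmxA inverse mulmx1.
have tB (W W' : 'M[R]_d) : \tr (W - W') = \tr W - \tr W' by rewrite linearB.
rewrite tB -!scalemxAr -scalemxAl !mxtraceZ.
have -> : \tr (B *m Sg *m B *m Sg) = \tr (Sg *m B *m Sg *m B).
  by rewrite -SB -!mulmxA -SB !mulmxA.
lra.
Qed.

End MomentBound.
End TraceBounds.

(** * Risk of linear rules *)

Section MeasurableMatrices.
Context {dT} {T : measurableType dT} {R : realType}.

Definition mx_measurable {p q} (F : T -> 'M[R]_(p, q)) :=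
  forall i j, measurable_fun setT (fun t => F t i j).

Lemma mx_measurable_cst {p q} (A : 'M[R]_(p, q)) : mx_measurable (fun=> A).
Proof. by move=> i j; exact: measurable_cst. Qed.

Lemma mx_measurableM {p q r} (F : T -> 'M[R]_(p, q)) (G : T -> 'M[R]_(q, r)) :
  mx_measurable F -> mx_measurable G -> mx_measurable (fun t => F t *m G t).
Proof.
move=> mF mG i j; under eq_fun do rewrite mxE.
by apply: measurable_sum => k; apply: measurable_funM.
Qed.

Lemma mx_measurableD {p q} (F G : T -> 'M[R]_(p, q)) :
  mx_measurable F -> mx_measurable G -> mx_measurable (fun t => F t + G t).
Proof.
by move=> mF mG i j; under eq_fun do rewrite mxE; exact: measurable_funD.
Qed.

Lemma mx_measurableB {p q} (F G : T -> 'M[R]_(p, q)) :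
  mx_measurable F -> mx_measurable G -> mx_measurable (fun t => F t - G t).
Proof.
move=> mF mG i j; under eq_fun do rewrite !mxE; exact: measurable_funB.
Qed.

Lemma mx_measurable_tr {p q} (F : T -> 'M[R]_(p, q)) :
  mx_measurable F -> mx_measurable (fun t => (F t)^T).
Proof. by move=> mF i j; under eq_fun do rewrite mxE; exact: mF. Qed.

Lemma mx_measurable_det {p} (F : T -> 'M[R]_p) :
  mx_measurable F -> measurable_fun setT (fun t => \det (F t)).
Proof.
move=> mF; apply: measurable_sum => s; apply: measurable_funM => //.
by apply: measurable_prod => i _; exact: mF.
Qed.

(** Writing 1/x as x times (x^2)^{-1} reduces inversion to a real power of a nonnegative number; at
    x = 0 both sides are 0 by convention. *)
Lemma measurable_inverse (f : T -> R) :
  measurable_fun setT f -> measurable_fun setT (fun t => (f t)^-1).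
Proof.
move=> mf; rewrite (_ : (fun t => _) = fun t => f t * ((f t ^+ 2) `^ (-1))).
  apply: measurable_funM => //.
  apply: (@measurableT_comp _ _ _ _ _ _ (fun x : R => x `^ (-1))).
    exact: measurable_powR.
  exact: measurable_funX.
apply/funext => t; rewrite powR_inv1 ?sqr_ge0//.
have [->|f0] := eqVneq (f t) 0; first by rewrite invr0 mul0r.
by rewrite expr2 invfM mulrA mulfV// mul1r.
Qed.

(** Cramer's rule: the entries are cofactors over the determinant, and determinants are polynomial
    in the entries. *)
Lemma mx_measurable_inv {p} (F : T -> 'M[R]_p) : (forall t, F t \in unitmx) ->
  mx_measurable F -> mx_measurable (fun t => invmx (F t)).
Proof.
move=> uF mF i j.
under eq_fun do rewrite /invmx uF !mxE.
apply: measurable_funM.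
  by apply: measurable_inverse; exact: mx_measurable_det.
apply: measurable_funM => //; apply: mx_measurable_det => a b.
by under eq_fun do rewrite !mxE; exact: mF.
Qed.

Lemma mx_measurable_dotc {p} (F G : T -> 'cV[R]_p) :
  mx_measurable F -> mx_measurable G -> measurable_fun setT (fun t => dotc (F t) (G t)).
Proof. by move=> mF mG; apply: mx_measurableM => //; exact: mx_measurable_tr. Qed.

Lemma mx_measurable_trace {p} (F : T -> 'M[R]_p) :
  mx_measurable F -> measurable_fun setT (fun t => \tr (F t)).
Proof. by move=> mF; apply: measurable_sum => i; exact: mF. Qed.

End MeasurableMatrices.

(** * Averaging the prediction error over the prior and the noise *)

Section BayesRisk.
Context {R : realType} {d n : nat} {dO} {Omega : measurableType dO}.
Variables (P : probability Omega R).
Context {dU} {UT : measurableType dU}.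
Variables (nu : probability (d.-tuple R) R) (mu : probability (d.-tuple R * R)%type R).
Variables (th : Omega -> d.-tuple R) (Z : 'I_n.+1 -> Omega -> (d.-tuple R * R)%type)
  (U : Omega -> UT).
Variables (Hh : 'M[R]_d) (s : R).
Hypotheses (HhT : Hh^T = Hh) (HhE : Hh *m Hh = H_of nu) (s0 : 0 < s).

Definition white_train (t : n.-tuple (d.-tuple R)) : 'M[R]_(d, n) :=
  \matrix_(j, i) (Hh *m tcol (tnth t i)) j 0.

Definition observed (w : Omega) := (((Z ord0 w).1, train_inputs Z w), U w).

Lemma prior_form (v : 'I_d -> R) :
  \sum_j \sum_k H_of nu j k * (v j * v k) = sqnorm (Hh *m \col_j v j).
Proof.
rewrite sqnorm_dotc dotc_mulr mulmxA HhT HhE dotcC dotcE.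
apply: eq_bigr => j _; rewrite [(\col__ _) j 0]mxE [(_ *m _) j 0]mxE mulr_sumr.
by apply: eq_bigr => k _; rewrite [(\col__ _) k 0]mxE; ring.
Qed.

Lemma prior_form_ge0 (v : 'I_d -> R) :
  0 <= \sum_j \sum_k H_of nu j k * (v j * v k).
Proof. by rewrite prior_form sqnorm_dotc dotc_ge0. Qed.

Lemma measurable_observed :
  @measurable_fun _ _ (g_sigma_algebraType (rects (noise_rects Z U))) _ setT observed.
Proof.
apply/measurable_fun_pairP; split => /=.
  apply/measurable_fun_pairP; split => /=.
    apply: (@rects_coordinate _ _ _ _ _ _ _ Z U _ _ (inr ord0) (fst \o Z ord0)) => //.
  apply/(@measurable_fun_tnthP _ _ (g_sigma_algebraType (rects (noise_rects Z U)))) => i.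
  rewrite (_ : _ \o _ = fst \o Z (lift ord0 i)); last first.
    by apply/funext => w /=; rewrite tnth_mktuple.
  exact: (@rects_coordinate _ _ _ _ _ _ _ Z U _ _ (inr (lift ord0 i))).
exact: (@rects_coordinate _ _ _ _ _ _ _ Z U _ _ (inl false) U).
Qed.

Hypothesis real : realization P nu mu th Z U.
Hypothesis noise : @noise_cond R d mu s.
Hypothesis nu2 : forall j : 'I_d, nu.-integrable setT (fun t => ((tnth t j) ^+ 2)%:E).

Definition rule_col (l : 'I_n -> (d.-tuple R * n.-tuple (d.-tuple R)) * UT -> R) w :
  'cV[R]_n := \col_i l i (observed w).

Definition white_residual l w : 'cV[R]_d :=
  Hh *m tcol (Z ord0 w).1 - white_train (train_inputs Z w) *m rule_col l w.

(** The prediction error is linear in theta and the noises, with coefficients that depend only on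
    the inputs and [U]. The theta block then gives v^T H v = |H^{1/2} v|^2, the squared whitened
    residual. The identity also holds when both sides are [+oo]. *)
Lemma bayes_risk (noisy : bool) (l : 'I_n -> (d.-tuple R * n.-tuple (d.-tuple R)) * UT -> R) :
  (forall i, measurable_fun setT (l i)) ->
  (\int[P]_w ((resp noisy th Z ord0 w - pred_at_test noisy l th Z U w) ^+ 2)%:E =
   \int[P]_w ((if noisy then s + s * dotc (rule_col l w) (rule_col l w) else 0) +
              sqnorm (white_residual l w))%:E)%E.
Proof.
move=> ml.
pose v (y : (d.-tuple R * n.-tuple (d.-tuple R)) * UT) (j : 'I_d) :=
  tnth y.1.1 j - \sum_i l i y * tnth (tnth y.1.2 i) j.
(* Coefficients of the sources: 1 for the test noise and [- l i] for a training noise, or 0 for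
   every noise in the noiseless experiment, which keeps the same law [mu]. *)
pose g (a : 'I_d + 'I_n.+1) (y : (d.-tuple R * n.-tuple (d.-tuple R)) * UT) : R :=
  match a with
  | inl j => v y j
  | inr k => if noisy then (if unlift ord0 k is Some i then - l i y else 1) else 0
  end.
have mg a : measurable_fun setT (g a).
  case: a => [j|k] /=.
    apply: measurable_funB.
      exact: (measurableT_comp (measurable_tnth j) (measurableT_comp measurable_fst measurable_fst)).
    apply: measurable_sum => i; apply: measurable_funM => //.
    apply: (measurableT_comp (measurable_tnth j)).
    apply: (measurableT_comp (measurable_tnth i)).
    exact: (measurableT_comp measurable_snd measurable_fst).
  rewrite /g; case: (noisy) => //; case: (unliftP ord0 k) => [i _|_] //.
  exact: (measurableT_comp (@oppr_measurable R setT) (ml i)).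
have mgo a : sub_measurable (rects (noise_rects Z U)) (fun w => g a (observed w)).
  apply: (@measurableT_comp _ _ _ (g_sigma_algebraType (rects (noise_rects Z U))) _ _ (g a)) => //.
  exact: measurable_observed.
have H := noisy_second_moment real s0 noise nu2 prior_form_ge0 mgo.
transitivity (\int[P]_w (\sum_a \sum_b source_cov nu s a b *
   (g a (observed w) * g b (observed w)))%:E)%E.
  rewrite -H.
  apply: eq_integral => w _; congr (_ ^+ 2)%:E.
  rewrite big_sumType/= big_ord_recl unlift_none.
  rewrite (eq_bigr (fun i => (if noisy then - l i (observed w) else 0) * (Z (lift ord0 i) w).2)); last first.
    by move=> i _; rewrite liftK.
  have E1 : \sum_(j < d) v (observed w) j * tnth (th w) j =
      dotv (Z ord0 w).1 (th w) - \sum_i l i (observed w) * dotv (Z (lift ord0 i) w).1 (th w).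
    rewrite /dotv.
    under [X in _ = _ - X]eq_bigr do rewrite mulr_sumr.
    rewrite exchange_big/= -sumrB; apply: eq_bigr => j _.
    rewrite /v mulrBl mulr_suml; congr (_ - _); apply: eq_bigr => i _.
    by rewrite tnth_mktuple mulrA.
  rewrite E1 /pred_at_test /resp -/(observed w).
  case: (noisy).
    rewrite mul1r; under [X in _ - X = _]eq_bigr do rewrite mulrDr.
    rewrite big_split/=; under [X in _ = _ + (_ + X)]eq_bigr do rewrite mulNr.
    by rewrite sumrN; ring.
  rewrite mul0r add0r [X in _ = _ + X]big1 ?addr0; last by move=> i _; rewrite mul0r.
  by under eq_bigr do rewrite addr0.
apply: eq_integral => w _; congr EFin; rewrite big_sumType/= addrC; congr (_ + _); last first.
  have vE : \col_j v (observed w) j = tcol (Z ord0 w).1 -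
      \sum_i l i (observed w) *: tcol (tnth (train_inputs Z w) i).
    apply/matrixP => j k; rewrite (ord1 k) !mxE summxE; congr (_ - _).
    by apply: eq_bigr => i _; rewrite !mxE.
  rewrite (eq_bigr (fun j => \sum_k H_of nu j k * (v (observed w) j * v (observed w) k))); last first.
    by move=> j _; rewrite big_sumType/= [X in _ + X]big1 ?addr0// => k _; rewrite mul0r.
  rewrite prior_form; congr sqnorm; rewrite vE mulmxBr /white_residual; congr (_ - _).
  apply/matrixP => j k; rewrite mulmx_sumr summxE mxE; apply: eq_bigr => i _.
  by rewrite (ord1 k) -scalemxAr [LHS]mxE [white_train _ j i]mxE [rule_col l w i 0]mxE mulrC.
rewrite (eq_bigr (fun k => s * (g (inr k) (observed w)) ^+ 2)); last first.
  move=> k _; rewrite big_sumType/= big1 ?add0r; last by move=> j _; rewrite mul0r.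
  rewrite (bigD1 k)//= eqxx big1 ?addr0 ?expr2// => i ik.
  by rewrite eq_sym (negbTE ik) mul0r.
rewrite big_ord_recl /= unlift_none; case: (noisy) => /=.
  rewrite expr1n mulr1 dotcE mulr_sumr; congr (_ + _); apply: eq_bigr => i _.
  by rewrite liftK sqrrN !mxE expr2.
by rewrite expr0n/= mulr0 add0r big1// => i _; rewrite expr0n/= mulr0.
Qed.

End BayesRisk.

(** * Second and fourth moments of a whitened input *)

Section Population.
Context {R : realType} {d : nat}.
Variable (mu : probability (d.-tuple R * R)%type R).
Variables (Hh : 'M[R]_d) (L2 : R).
Hypothesis mu2 : forall j : 'I_d, mu.-integrable setT (fun z => ((tnth z.1 j) ^+ 2)%:E).
Hypothesis HhT : Hh^T = Hh.
Let Sg := Hh *m Sigma_of mu *m Hh.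

Definition white (z : d.-tuple R * R) : 'cV[R]_d := Hh *m tcol z.1.

Lemma white_prodE a b z : white z a 0 * white z b 0 =
  \sum_j \sum_k (Hh a j * Hh b k) * (tnth z.1 j * tnth z.1 k).
Proof.
rewrite !mxE mulr_suml; apply: eq_bigr => j _; rewrite mulr_sumr.
by apply: eq_bigr => k _; rewrite !mxE; ring.
Qed.

Let integrable_term a b j k :
  rintegrable mu (fun z => (Hh a j * Hh b k) * (tnth z.1 j * tnth z.1 k)).
Proof. by apply: rintegrableZ; exact: rintegrable_input2. Qed.

Lemma rintegrable_white2 a b :
  rintegrable mu (fun z => white z a 0 * white z b 0).
Proof.
under eq_fun do rewrite white_prodE.
by apply: rintegrable_sum => j _; exact: rintegrable_sum.
Qed.

Lemma Rintegral_white2 a b :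
  Rintegral mu setT (fun z => white z a 0 * white z b 0) = Sg a b.
Proof.
under eq_Rintegral do rewrite white_prodE.
rewrite Rintegral_sum; last by move=> j _; exact: rintegrable_sum.
rewrite (eq_bigr (fun j => \sum_k (Hh a j * Hh b k) * Sigma_of mu j k)); last first.
  move=> j _; rewrite Rintegral_sum//; apply: eq_bigr => k _.
  rewrite (RintegralZl _ measurableT (rintegrable_input2 mu2 j k)).
  by rewrite [Sigma_of mu j k]mxE.
rewrite exchange_big /= [RHS]mxE; apply: eq_bigr => k _.
rewrite [(_ *m _) a k]mxE mulr_suml; apply: eq_bigr => j _.
by rewrite mulrAC; congr (_ * _); rewrite -[in LHS]HhT mxE.
Qed.

Lemma measurable_white a : measurable_fun setT (fun z => white z a 0).
Proof.
apply: mx_measurableM; first exact: mx_measurable_cst.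
by move=> i j; under eq_fun do rewrite mxE; exact: measurable_input.
Qed.

Let quadE (W : 'M[R]_d) (v : 'cV[R]_d) : quad W v = \sum_a \sum_b W a b * (v a 0 * v b 0) :> R.
Proof.
rewrite quad_dotc dotcE; apply: eq_bigr => a _; rewrite mxE mulr_sumr.
by apply: eq_bigr => b _; ring.
Qed.

Lemma Rintegral_form (I : finType) (f : d.-tuple R * R -> R) (W : I -> I -> R)
    (u : d.-tuple R * R -> I -> R) :
  (forall a b, rintegrable mu (fun z => f z * (u z a * u z b))) ->
  Rintegral mu setT (fun z => \sum_a \sum_b W a b * (f z * (u z a * u z b))) =
  \sum_a \sum_b W a b * Rintegral mu setT (fun z => f z * (u z a * u z b)).
Proof.
move=> iu; rewrite Rintegral_sum; last first.
  by move=> a _; apply: rintegrable_sum => b _; exact: rintegrableZ.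
apply: eq_bigr => a _; rewrite Rintegral_sum; last by move=> b _; exact: rintegrableZ.
by apply: eq_bigr => b _; rewrite RintegralZl//; exact: iu.
Qed.

Let i1 a b : rintegrable mu (fun z => 1 * (white z a 0 * white z b 0)).
Proof. by under eq_fun do rewrite mul1r; exact: rintegrable_white2. Qed.

Lemma white_cov_sym : Sg^T = Sg.
Proof.
apply/matrixP => a b; rewrite mxE -!Rintegral_white2.
by apply: eq_Rintegral => z _; rewrite mulrC.
Qed.

Lemma white_cov_trace W :
  \tr (Sg *m W) = Rintegral mu setT (fun z => quad W (white z)).
Proof.
rewrite mxtrace_mulC.
rewrite [RHS](@eq_Rintegral _ _ _ _ _ (fun z => \sum_a \sum_b W a b *
  (1 * (white z a 0 * white z b 0)))); last first.
  by move=> z _; rewrite quadE; do 2 (apply: eq_bigr => ? _); rewrite mul1r.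
rewrite (Rintegral_form _ i1); apply: eq_bigr => a _; rewrite mxE.
apply: eq_bigr => b _; rewrite -[in LHS]white_cov_sym mxE -Rintegral_white2.
by congr (_ * _); apply: eq_Rintegral => z _; rewrite mul1r.
Qed.

Lemma white_cov_dual W : quad_ge0 W -> 0 <= \tr (Sg *m W).
Proof. by move=> W0; rewrite white_cov_trace; apply: Rintegral_ge0 => z _; exact: W0. Qed.

Lemma white_cov_quad_ge0 : quad_ge0 Sg.
Proof.
move=> v; rewrite (_ : quad _ _ = \tr (Sg *m (v *m v^T))).
  apply: white_cov_dual => u; rewrite quad_dotc -mulmxA dotc_mulr.
  exact: dotc_ge0.
by rewrite mulmxA mxtrace_mulC mulmxA /mxtrace big_ord1.
Qed.

Hypothesis K4_bound : forall v : 'cV[R]_d,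
  (\int[mu]_z ((sqnorm (white z)) * ((v^T *m white z) 0 0) ^+ 2)%:E
   <= (L2 * quad Sg v)%:E)%E.

Definition fourth_moment : 'M[R]_d := \matrix_(a, b)
  Rintegral mu setT (fun z => sqnorm (white z) * (white z a 0 * white z b 0)).

Lemma measurable_white_sqnorm : measurable_fun setT (fun z => sqnorm (white z)).
Proof. by apply: measurable_sum => a; apply: measurable_funX; exact: measurable_white. Qed.

Lemma sqnorm_ge0 (v : 'cV[R]_d) : 0 <= sqnorm v.
Proof. by rewrite sqnorm_dotc dotc_ge0. Qed.

Let sq_int (v : 'cV[R]_d) :
  rintegrable mu (fun z => sqnorm (white z) * ((v^T *m white z) 0 0) ^+ 2).
Proof.
apply/integrableP; split.
  apply/measurable_EFinP; apply: measurable_funM; first exact: measurable_white_sqnorm.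
  apply: measurable_funX; apply: mx_measurableM; first exact: mx_measurable_cst.
  by move=> i j; rewrite (ord1 j); exact: measurable_white.
apply: (@le_lt_trans _ _ (L2 * quad Sg v)%:E); last exact: ltry.
rewrite (eq_integral (fun z => (sqnorm (white z) * ((v^T *m white z) 0 0) ^+ 2)%:E)).
  exact: K4_bound.
by move=> z _; rewrite /= ger0_norm// mulr_ge0 ?sqnorm_ge0 ?sqr_ge0.
Qed.

(** Basis vectors in the Loewner bound make each |x|^2 x_a^2 integrable; mixed entries follow from
    |x_a x_b| <= x_a^2 + x_b^2. *)
Lemma rintegrable_white4 a b :
  rintegrable mu (fun z => sqnorm (white z) * (white z a 0 * white z b 0)).
Proof.
have E (c : 'I_d) z : ((delta_mx c 0 : 'cV[R]_d)^T *m white z) 0 0 = white z c 0.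
  by rewrite trmx_delta -rowE mxE.
apply: (rintegrable_le _ (rintegrableD (sq_int (delta_mx a 0)) (sq_int (delta_mx b 0)))).
  apply: measurable_funM; first exact: measurable_white_sqnorm.
  by apply: measurable_funM; exact: measurable_white.
move=> z; rewrite !E -mulrDr !normrM [`|sqnorm _|]ger0_norm ?sqnorm_ge0//.
apply: ler_wpM2l; first exact: sqnorm_ge0.
rewrite [leRHS]ger0_norm ?addr_ge0 ?sqr_ge0//.
rewrite -(real_normK (num_real (white z a 0))) -(real_normK (num_real (white z b 0))).
have := sqr_ge0 (`|white z a 0| - `|white z b 0|).
by have := normr_ge0 (white z a 0); have := normr_ge0 (white z b 0); nra.
Qed.

Lemma fourth_moment_le : quad_ge0 (L2 *: Sg - fourth_moment).
Proof.
move=> v; rewrite quadE.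
have <- : L2 * quad Sg v - quad fourth_moment v =
    \sum_a \sum_b (L2 *: Sg - fourth_moment) a b * (v a 0 * v b 0).
  rewrite !quadE mulr_sumr -sumrB; apply: eq_bigr => a _.
  rewrite mulr_sumr -sumrB; apply: eq_bigr => b _.
  have -> : (L2 *: Sg - fourth_moment) a b = L2 * Sg a b - fourth_moment a b.
    by rewrite [LHS]mxE [X in X + _ = _]mxE [X in _ + X = _]mxE.
  ring.
rewrite subr_ge0; have := K4_bound v; rewrite EFin_Rintegral// lee_fin.
apply: le_trans; rewrite le_eqVlt; apply/orP; left; apply/eqP.
rewrite [RHS](@eq_Rintegral _ _ _ _ _ (fun z => \sum_a \sum_b (v a 0 * v b 0) *
  (sqnorm (white z) * (white z a 0 * white z b 0)))); last first.
  move=> z _; rewrite [(v^T *m _) 0 0]dotcE expr2 mulr_suml mulr_sumr.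
  apply: eq_bigr => a _; rewrite !mulr_sumr; apply: eq_bigr => b _; ring.
rewrite (Rintegral_form (fun a b => v a 0 * v b 0) rintegrable_white4) quadE.
by do 2 (apply: eq_bigr => ? _); rewrite mxE mulrC.
Qed.

End Population.

(** * Moments of the Gram matrix and the mean squared norm of the ridge weights *)

Section RidgeRisk.
Context {R : realType} {d n : nat} {dO} {Omega : measurableType dO}.
Variables (P : probability Omega R).
Context {dU} {UT : measurableType dU}.
Variables (nu : probability (d.-tuple R) R) (mu : probability (d.-tuple R * R)%type R).
Variables (th : Omega -> d.-tuple R) (Z : 'I_n.+1 -> Omega -> (d.-tuple R * R)%type)
  (U : Omega -> UT).
Variables (Hh : 'M[R]_d) (s L2 : R).
Hypotheses (n0 : (0 < n)%N) (s0 : 0 < s) (L20 : 0 <= L2) (HhT : Hh^T = Hh).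
Hypothesis mu2 : forall j : 'I_d, mu.-integrable setT (fun z => ((tnth z.1 j) ^+ 2)%:E).
Let Sg := Hh *m Sigma_of mu *m Hh.
Hypothesis K4_bound : forall v : 'cV[R]_d,
  (\int[mu]_z ((sqnorm (white Hh z)) * ((v^T *m white Hh z) 0 0) ^+ 2)%:E
   <= (L2 * quad Sg v)%:E)%E.
Hypothesis real : realization P nu mu th Z U.
Let K4 := fourth_moment mu Hh.
Let mZ i : measurable_fun setT (Z i). Proof. by have [[]] := real. Qed.
Let lZ i B : measurable B -> P (Z i @^-1` B) = mu B. Proof. by have [_ _ + _] := real; apply. Qed.

Definition mean_mx {p q} (F : Omega -> 'M[R]_(p, q)) : 'M[R]_(p, q) :=
  \matrix_(a, b) Rintegral P setT (fun w => F w a b).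

Definition mx_rintegrable {p q} (F : Omega -> 'M[R]_(p, q)) :=
  forall a b, rintegrable P (fun w => F w a b).

Lemma rintegrable_trace (A : 'M[R]_d) (F : Omega -> 'M[R]_d) : mx_rintegrable F ->
  rintegrable P (fun w => \tr (A *m F w)).
Proof.
move=> iF; apply: rintegrable_sum => a _; under eq_fun do rewrite mxE.
by apply: rintegrable_sum => b _; apply: rintegrableZ; exact: iF.
Qed.

Lemma Rintegral_trace (A : 'M[R]_d) (F : Omega -> 'M[R]_d) : mx_rintegrable F ->
  Rintegral P setT (fun w => \tr (A *m F w)) = \tr (A *m mean_mx F).
Proof.
move=> iF; have iAF a b : rintegrable P (fun w => A a b * F w b a).
  by apply: rintegrableZ; exact: iF.
rewrite (@eq_Rintegral _ _ _ _ _ (fun w => \sum_a \sum_b A a b * F w b a)); last first.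
  by move=> w _; apply: eq_bigr => a _; rewrite mxE.
rewrite Rintegral_sum; last by move=> a _; exact: rintegrable_sum.
apply: eq_bigr => a _; rewrite mxE Rintegral_sum//; apply: eq_bigr => b _.
by rewrite (RintegralZl _ measurableT (iF b a)) mxE.
Qed.

Let X w := white_train Hh (train_inputs Z w).
Let x i w := white Hh (Z (lift ord0 i) w).
Let S w := X w *m (X w)^T.

Let XE w j i : X w j i = x i w j 0.
Proof. by rewrite mxE tnth_mktuple. Qed.

Let SE w a b : S w a b = \sum_i x i w a 0 * x i w b 0.
Proof. by rewrite mxE; apply: eq_bigr => i _; rewrite [_^T _ _]mxE !XE. Qed.

Let x2_int i a b : rintegrable P (fun w => x i w a 0 * x i w b 0).
Proof. by have := rintegrable_law (@mZ (lift ord0 i)) (@lZ (lift ord0 i)) (rintegrable_white2 Hh mu2 a b). Qed.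

Let x2_mean i a b : Rintegral P setT (fun w => x i w a 0 * x i w b 0) = Sg a b.
Proof.
have := Rintegral_law (@mZ (lift ord0 i)) (@lZ _) measurableT (rintegrable_white2 Hh mu2 a b).
by rewrite preimage_setT Rintegral_white2.
Qed.

Lemma gram_rintegrable : mx_rintegrable S.
Proof. by move=> a b; under eq_fun do rewrite SE; exact: rintegrable_sum. Qed.

Lemma gram_mean : mean_mx S = n%:R *: Sg.
Proof.
apply/matrixP => a b; rewrite mxE [RHS]mxE.
under eq_Rintegral do rewrite SE.
rewrite Rintegral_sum//; under eq_bigr do rewrite x2_mean.
by rewrite sumr_const card_ord mulr_natl.
Qed.

(** Entry of x_i x_i^T x_i' x_i'^T, so that S^2 is the double sum. Diagonal terms are |x_i|^2 x_i
    x_i^T and yield the fourth moment; the others are products of independent matrices. *)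
Let cross i i' a b w : R := \sum_c (x i w a 0 * x i w c 0) * (x i' w c 0 * x i' w b 0).

Let SSE w a b : (S w *m S w) a b = \sum_i \sum_i' cross i i' a b w.
Proof.
rewrite mxE; under eq_bigr do rewrite !SE mulr_suml.
rewrite exchange_big/=; apply: eq_bigr => i _; rewrite /cross.
rewrite exchange_big/=; apply: eq_bigr => c _; rewrite mulr_sumr.
by apply: eq_bigr.
Qed.

Let cross_facts i i' a b : rintegrable P (cross i i' a b) /\
  Rintegral P setT (cross i i' a b) = if i' == i then K4 a b else (Sg *m Sg) a b.
Proof.
case: eqVneq => [->|ii'].
  have E w : cross i i a b w = sqnorm (x i w) * (x i w a 0 * x i w b 0).
    by rewrite /cross /sqnorm mulr_suml; apply: eq_bigr => c _; ring.
  have i4 := rintegrable_white4 K4_bound a b.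
  have := rintegrable_law (@mZ (lift ord0 i)) (@lZ _) i4.
  have := Rintegral_law (@mZ (lift ord0 i)) (@lZ _) measurableT i4.
  rewrite preimage_setT => e j; split.
    by move: j; apply: eq_integrable => // w _ /=; rewrite E.
  rewrite [RHS]mxE -e; apply: eq_Rintegral => w _; exact: E.
have ll : lift ord0 i != lift ord0 i' by rewrite (inj_eq lift_inj) eq_sym.
have pr c := pair_independent real ll (rintegrable_white2 Hh mu2 a c)
  (rintegrable_white2 Hh mu2 c b).
split; first by apply: rintegrable_sum => c _; exact: (pr c).1.
rewrite [LHS]Rintegral_sum; last by move=> c _; exact: (pr c).1.
rewrite mxE; apply: eq_bigr => c _; rewrite [LHS](pr c).2.
by rewrite !Rintegral_white2.
Qed.

Lemma gram_sq_rintegrable : mx_rintegrable (fun w => S w *m S w).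
Proof.
move=> a b; under eq_fun do rewrite SSE.
by do 2 (apply: rintegrable_sum => ? _); exact: (cross_facts _ _ _ _).1.
Qed.

Lemma gram_sq_mean : mean_mx (fun w => S w *m S w) =
  (n%:R * (n%:R - 1)) *: (Sg *m Sg) + n%:R *: K4.
Proof.
apply/matrixP => a b; rewrite mxE.
under eq_Rintegral do rewrite SSE.
rewrite Rintegral_sum; last first.
  by move=> i _; apply: rintegrable_sum => i' _; exact: (cross_facts _ _ _ _).1.
rewrite (eq_bigr (fun=> (n%:R - 1) * (Sg *m Sg) a b + K4 a b)); last first.
  move=> i _; rewrite Rintegral_sum; last by move=> i' _; exact: (cross_facts _ _ _ _).1.
  under eq_bigr do rewrite (cross_facts _ _ _ _).2.
  rewrite (bigD1 i)//= eqxx addrC; congr (_ + _).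
  rewrite (eq_bigr (fun=> (Sg *m Sg) a b)); last by move=> i' /negbTE ->.
  have e : n.-1%:R = n%:R - 1 :> R by rewrite -subn1 natrB.
  by rewrite sumr_const cardC1 card_ord -e mulr_natl.
rewrite sumr_const card_ord -mulr_natl [RHS]mxE [X in _ = X + _]mxE.
by rewrite [X in _ = _ + X]mxE; ring.
Qed.

Let M w := invmx (S w + s%:M).

(** The bound is delivered through an integrable minorant because the integrability of the trace
    itself is not known at this point. *)
Lemma mean_trace_ge : exists low : Omega -> R,
  [/\ rintegrable P low,
      (forall w, low w <= \tr (Sg *m M w *m S w *m M w)) &
      n%:R^-1 * df2 Sg ((s + L2) / n%:R) <= Rintegral P setT low].
Proof.
have dual := white_cov_dual mu2 HhT.
have sym := white_cov_sym mu2 HhT.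
have pos := white_cov_quad_ge0 mu2 HhT.
have [B [BT SB inverse ->]] := scaled_resolvent_exists sym pos n0 s0 L20.
pose A := B *m Sg *m B.
(* The affine minorant of [trace_ridge_ge], cyclically rearranged so that each term is the trace of
   a constant matrix times a random one. *)
exists (fun w => 4 * \tr (A *m S w) - 2 * \tr (B *m A *m (S w *m S w + s *: S w))
   - \tr (A *m S w)).
have iS := gram_rintegrable; have iSS := gram_sq_rintegrable.
have iSs : mx_rintegrable (fun w => S w *m S w + s *: S w).
  move=> a b; under eq_fun do rewrite mxE [X in _ + X]mxE.
  by apply: rintegrableD; [exact: iSS|apply: rintegrableZ; exact: iS].
have t1 := rintegrable_trace A iS; have t2 := rintegrable_trace (B *m A) iSs.
have u1 := rintegrableZ 4 t1; have u2 := rintegrableZ 2 t2.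
have cyc (W : 'M[R]_d) : \tr (B *m A *m W) = \tr (A *m W *m B).
  by rewrite [RHS]mxtrace_mulC (mulmxA B A W).
have cyc2 (W : 'M[R]_d) : \tr (Sg *m B *m W *m B) = \tr (A *m W).
  by rewrite mxtrace_mulC /A !mulmxA.
split; first by apply: rintegrableB => //; exact: rintegrableB.
- move=> w; have phi W (W0 : quad_ge0 W) := scaled_resolvent_dual dual sym s0 L20 BT inverse W0.
  have := @trace_ridge_ge _ _ Sg dual _ (X w) s B s0 BT SB phi.
  by rewrite cyc -cyc2 /A.
rewrite RintegralB//; last exact: rintegrableB.
rewrite RintegralB// !RintegralZl// !Rintegral_trace//.
have -> : mean_mx (fun w => S w *m S w + s *: S w) =
    mean_mx (fun w => S w *m S w) + s *: mean_mx S.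
  apply/matrixP => a b; rewrite !mxE -(RintegralZl s measurableT (iS a b)).
  rewrite -RintegralD//; [|exact: iSS|by apply: rintegrableZ; exact: iS].
  by apply: eq_Rintegral => w _; rewrite mxE [X in _ + X]mxE.
rewrite cyc -[X in _ - X]cyc2.
exact: (expected_trace_ge dual sym n0 s0 L20 (fourth_moment_le K4_bound) BT SB
  inverse gram_mean gram_sq_mean).
Qed.


Definition ridge_rule (i : 'I_n) (y : (d.-tuple R * n.-tuple (d.-tuple R)) * UT) : R :=
  let Xt := white_train Hh y.1.2 in
  (Xt^T *m invmx (Xt *m Xt^T + s%:M) *m (Hh *m tcol y.1.1)) i 0.

Lemma measurable_white_train :
  mx_measurable (fun t : n.-tuple (d.-tuple R) => white_train Hh t).
Proof.
move=> j i; under eq_fun do rewrite mxE.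
apply: mx_measurableM => [|a b]; first exact: mx_measurable_cst.
under eq_fun do rewrite mxE.
exact: (measurableT_comp (measurable_tnth a) (measurable_tnth i)).
Qed.

Lemma measurable_ridge_coef :
  mx_measurable (fun t : n.-tuple (d.-tuple R) =>
    (white_train Hh t)^T *m invmx (white_train Hh t *m (white_train Hh t)^T + s%:M)).
Proof.
have mX := measurable_white_train.
apply: mx_measurableM; first exact: mx_measurable_tr.
apply: mx_measurable_inv => [t|]; first exact: ridge_unit.
apply: mx_measurableD; last exact: mx_measurable_cst.
by apply: mx_measurableM => //; exact: mx_measurable_tr.
Qed.

Lemma measurable_ridge_rule i : measurable_fun setT (ridge_rule i).
Proof.
apply: (@mx_measurableM _ _ _ _ _ _ (fun y : (d.-tuple R * n.-tuple (d.-tuple R)) * UT =>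
  (white_train Hh y.1.2)^T *m
    invmx (white_train Hh y.1.2 *m (white_train Hh y.1.2)^T + s%:M))).
  move=> a b; apply: (measurableT_comp (@measurable_ridge_coef a b)).
  exact: (measurableT_comp measurable_snd measurable_fst).
apply: mx_measurableM => [|a b]; first exact: mx_measurable_cst.
under eq_fun do rewrite mxE.
exact: (measurableT_comp (measurable_tnth a) (measurableT_comp measurable_fst measurable_fst)).
Qed.

Lemma ridge_rule_col w :
  rule_col Z U ridge_rule w = (X w)^T *m M w *m (Hh *m tcol (Z ord0 w).1).
Proof. by apply/matrixP => i j; rewrite mxE (ord1 j). Qed.


Lemma measurable_train_inputsT : measurable_fun setT (train_inputs Z).
Proof.
apply/measurable_fun_tnthP => i; rewrite (_ : _ \o _ = fst \o Z (lift ord0 i)).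
  exact: (measurableT_comp measurable_fst (mZ _)).
by apply/funext => w /=; rewrite tnth_mktuple.
Qed.

(** Each ridge weight is linear in the test input with coefficients fixed by the training inputs, so
    averaging its square over the test input replaces X_0 X_0^T by [Sigma_of mu]. The sum over the
    weights is a trace, rearranged cyclically. *)
Lemma ridge_rule_norm :
  (\int[P]_w (dotc (rule_col Z U ridge_rule w) (rule_col Z U ridge_rule w))%:E =
   \int[P]_w (\tr (Sg *m M w *m S w *m M w))%:E)%E.
Proof.
pose c (i : 'I_n) (a : 'I_d) (w : Omega) : R := ((X w)^T *m M w *m Hh) i a.
have mc0 : mx_measurable (fun t : n.-tuple (d.-tuple R) =>
    (white_train Hh t)^T *m invmx (white_train Hh t *m (white_train Hh t)^T + s%:M) *m Hh).
  by apply: mx_measurableM; [exact: measurable_ridge_coef|exact: mx_measurable_cst].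
have mc i a : sub_measurable (rects (test_rects Z)) (c i a).
  apply: (@measurableT_comp _ _ _ (g_sigma_algebraType (rects (test_rects Z))) _ _
    _ setT (train_inputs Z) (mc0 i a)).
  exact: measurable_train_inputs.
have mcT i a : measurable_fun setT (c i a).
  exact: (measurableT_comp (mc0 i a) measurable_train_inputsT).
have lE i w : rule_col Z U ridge_rule w i 0 = \sum_a c i a w * tnth (Z ord0 w).1 a.
  by rewrite ridge_rule_col mulmxA mxE; apply: eq_bigr => a _; rewrite [tcol _ a 0]mxE.
rewrite (eq_integral (fun w => (\sum_(i < n) ((\sum_a c i a w * tnth (Z ord0 w).1 a) ^+ 2)%:E)%E)); last first.
  move=> w _; rewrite dotcE -sumEFin; apply: eq_bigr => i _.
  by rewrite lE expr2.
have mx0 a : measurable_fun setT (fun w => tnth (Z ord0 w).1 a).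
  exact: (measurableT_comp (measurable_input a) (mZ ord0)).
rewrite ge0_integral_sum//; last first.
- by move=> i w _; rewrite lee_fin sqr_ge0.
- move=> i; apply/measurable_EFinP; apply: measurable_funX; apply: measurable_sum => a.
  exact: measurable_funM.
rewrite (eq_bigr (fun i => \int[P]_w (\sum_a \sum_b Sigma_of mu a b * (c i a w * c i b w))%:E)%E); last first.
  by move=> i _; exact: (test_second_moment real mu2 (mc i)).
rewrite -ge0_integral_sum//; last first.
- by move=> i w _; rewrite lee_fin; exact: (Sigma_ge0 mu2 (fun a => c i a w)).
- move=> i; apply/measurable_EFinP; apply: measurable_sum => a; apply: measurable_sum => b.
  by apply: measurable_funM => //; exact: measurable_funM.
apply: eq_integral => w _; rewrite sumEFin; congr EFin.
have MT : (M w)^T = M w by exact: ridge_inv_sym.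
pose C := (X w)^T *m M w *m Hh.
have -> : \tr (Sg *m M w *m S w *m M w) = \tr (C *m Sigma_of mu *m C^T).
  have -> : C *m Sigma_of mu *m C^T = (X w)^T *m (M w *m Sg *m M w *m X w).
    by rewrite /C !trmx_mul trmxK MT HhT /Sg !mulmxA.
  by rewrite [RHS]mxtrace_mulC [LHS]mxtrace_mulC /S !mulmxA.
apply: eq_bigr => i _; rewrite mxE exchange_big/=; apply: eq_bigr => b _.
rewrite [(C *m _) i b]mxE [C^T b i]mxE mulr_suml; apply: eq_bigr => a _.
by rewrite -/(C i a) /c -/C; ring.
Qed.

End RidgeRisk.

(** * The gap between noisy and noiseless excess *)

Section Gap.
Context {R : realType} {d n : nat}.
Variables (mu : probability (d.-tuple R * R)%type R) (nu : probability (d.-tuple R) R).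
Variables (Hh : 'M[R]_d) (s L2 : R).
Hypotheses (n0 : (0 < n)%N) (s0 : 0 < s) (L20 : 0 <= L2).
Hypothesis mu2 : forall j : 'I_d, mu.-integrable setT (fun z => ((tnth z.1 j) ^+ 2)%:E).
Hypothesis noise : @noise_cond R d mu s.
Hypothesis nu2 : forall j : 'I_d, nu.-integrable setT (fun t => ((tnth t j) ^+ 2)%:E).
Hypotheses (HhT : Hh^T = Hh) (HhE : Hh *m Hh = H_of nu).
Let Sg := Hh *m Sigma_of mu *m Hh.
Hypothesis K4_bound : forall v : 'cV[R]_d,
  (\int[mu]_z ((sqnorm (white Hh z)) * ((v^T *m white Hh z) 0 0) ^+ 2)%:E
   <= (L2 * quad Sg v)%:E)%E.

Let rate := n%:R^-1 * df2 Sg ((s + L2) / n%:R).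

Section OneRealization.
Context {dO} {Omega : measurableType dO} (P : probability Omega R).
Context {dU} {UT : measurableType dU}.
Variables (th : Omega -> d.-tuple R) (Z : 'I_n.+1 -> Omega -> (d.-tuple R * R)%type)
  (U : Omega -> UT).
Hypothesis real : realization P nu mu th Z U.

Let mZ i : measurable_fun setT (Z i). Proof. by have [[]] := real. Qed.
Let mU : measurable_fun setT U. Proof. by have [[]] := real. Qed.

Let mX : mx_measurable (fun w => white_train Hh (train_inputs Z w)).
Proof.
move=> j i.
exact: (measurableT_comp (measurable_white_train Hh j i) (measurable_train_inputsT real)).
Qed.

Lemma ridge_rule_norm_ge :
  (rate%:E <= \int[P]_w (dotc (rule_col Z U (ridge_rule Hh s) w)
                              (rule_col Z U (ridge_rule Hh s) w))%:E)%E.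
Proof.
rewrite (ridge_rule_norm s0 HhT mu2 real).
pose X w := white_train Hh (train_inputs Z w).
pose M w := invmx (X w *m (X w)^T + s%:M).
pose tr w := \tr (Sg *m M w *m (X w *m (X w)^T) *m M w).
rewrite -/(\int[P]_w (tr w)%:E)%E.
have [low [ilow lowtr hlow]] := mean_trace_ge n0 s0 L20 HhT mu2 K4_bound real.
have tr0 w : 0 <= tr w.
  have MT : (M w)^T = M w by exact: ridge_inv_sym.
  rewrite /tr -2!mulmxA; apply: (white_cov_dual mu2 HhT); rewrite mulmxA.
  by rewrite -{1}MT; apply: quad_ge0_congr; exact: quad_ge0_gram.
have mtr : measurable_fun setT tr.
  apply: mx_measurable_trace.
  have mS : mx_measurable (fun w => X w *m (X w)^T).
    by apply: mx_measurableM => //; exact: mx_measurable_tr.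
  have mM : mx_measurable M.
    apply: mx_measurable_inv => [w|]; first exact: ridge_unit.
    by apply: mx_measurableD => //; exact: mx_measurable_cst.
  by do 3 (apply: mx_measurableM => //); exact: mx_measurable_cst.
(* An infinite integral satisfies the bound trivially; a finite one makes the trace integrable and
   comparable with its minorant. *)
have [inf|fin] := eqVneq (\int[P]_w (tr w)%:E)%E +oo%E.
  by rewrite [X in (_ <= X)%E]inf leey.
have itr : rintegrable P tr.
  apply/integrableP; split; first exact/measurable_EFinP.
  rewrite (eq_integral (fun w => (tr w)%:E)); last by move=> w _; rewrite /= ger0_norm.
  by rewrite ltey.
rewrite [X in (_ <= X)%E](EFin_Rintegral itr) lee_fin.
by apply: le_trans hlow _; apply: le_Rintegral.
Qed.

(** Ridge weights minimise the integrand pointwise, and their objective splits into the noiseless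
    risk of the ridge rule plus s times the squared norm of its weights. Both parts are nonnegative,
    so the splitting is valid without finiteness of the risk of [l]. *)
Lemma noisy_excess_ge (l : 'I_n -> (d.-tuple R * n.-tuple (d.-tuple R)) * UT -> R) :
  (forall i, measurable_fun setT (l i)) ->
  (bayes_excess P false 0 (ridge_rule Hh s) th Z U + (s * rate)%:E <=
   bayes_excess P true s l th Z U)%E.
Proof.
move=> ml.
have mlr (i : 'I_n) : measurable_fun setT (ridge_rule (UT := UT) Hh s i).
  exact: measurable_ridge_rule.
rewrite /bayes_excess sube0.
rewrite (bayes_risk HhT HhE s0 real noise nu2 false mlr).
rewrite (bayes_risk HhT HhE s0 real noise nu2 true ml).
have mobs : measurable_fun setT (observed Z U).
  apply/measurable_fun_pairP; split => //=.
  apply/measurable_fun_pairP; split => /=.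
    exact: (measurableT_comp measurable_fst (mZ ord0)).
  exact: (measurable_train_inputsT real).
have mcol (l' : 'I_n -> (d.-tuple R * n.-tuple (d.-tuple R)) * UT -> R) :
    (forall i, measurable_fun setT (l' i)) -> mx_measurable (rule_col Z U l').
  move=> ml' i j; under eq_fun do rewrite mxE.
  exact: (measurableT_comp (ml' i) mobs).
have mx0 : mx_measurable (fun w => Hh *m tcol (Z ord0 w).1).
  apply: mx_measurableM => [|i j]; first exact: mx_measurable_cst.
  under eq_fun do rewrite mxE.
  exact: (measurableT_comp (measurable_input i) (mZ ord0)).
have mdot (l' : 'I_n -> (d.-tuple R * n.-tuple (d.-tuple R)) * UT -> R) :
    (forall i, measurable_fun setT (l' i)) ->
    measurable_fun setT (fun w => dotc (rule_col Z U l' w) (rule_col Z U l' w)).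
  by move=> ml'; apply: mx_measurable_dotc; exact: mcol.
have mres (l' : 'I_n -> (d.-tuple R * n.-tuple (d.-tuple R)) * UT -> R) :
    (forall i, measurable_fun setT (l' i)) ->
    measurable_fun setT (fun w => sqnorm (white_residual Z U Hh l' w)).
  move=> ml'; under eq_fun do rewrite sqnorm_dotc.
  have mr : mx_measurable (white_residual Z U Hh l').
    apply: mx_measurableB => //; apply: mx_measurableM => //; exact: mcol.
  exact: mx_measurable_dotc.
pose q (l' : 'I_n -> (d.-tuple R * n.-tuple (d.-tuple R)) * UT -> R) w :=
  s * dotc (rule_col Z U l' w) (rule_col Z U l' w) + sqnorm (white_residual Z U Hh l' w).
have mq l' : (forall i, measurable_fun setT (l' i)) -> measurable_fun setT (q l').
  move=> ml'; apply: measurable_funD; last exact: mres.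
  by apply: measurable_funM => //; exact: mdot.
have sdot0 l' w : 0 <= s * dotc (rule_col Z U l' w) (rule_col Z U l' w).
  by rewrite mulr_ge0 ?dotc_ge0// ltW.
have q0 l' w : 0 <= q l' w by rewrite addr_ge0// sqnorm_ge0.
have -> : (\int[P]_w (s + s * dotc (rule_col Z U l w) (rule_col Z U l w) +
    sqnorm (white_residual Z U Hh l w))%:E = s%:E + \int[P]_w (q l w)%:E)%E.
  rewrite (eq_integral (fun w => (s%:E + (q l w)%:E)%E)); last first.
    by move=> w _; rewrite -EFinD /q addrA.
  rewrite ge0_integralD//; last 3 first.
  - by move=> w _; rewrite lee_fin ltW.
  - by move=> w _; rewrite lee_fin.
  - by apply/measurable_EFinP; exact: mq.
  by rewrite integral_cst// [X in (_ * X)%E]probability_setT mule1.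
(* The test noise contributes exactly the constant [s] that the excess subtracts. *)
rewrite [X in (_ <= X)%E]addeAC subee// add0e.
apply: (@le_trans _ _ (\int[P]_w (q (ridge_rule Hh s) w)%:E)%E); last first.
  apply: ge0_le_integral => //.
  - by move=> w _; rewrite lee_fin.
  - by apply/measurable_EFinP; exact: mq.
  - by apply/measurable_EFinP; exact: mq.
  move=> w _; rewrite lee_fin /q addrC [leRHS]addrC.
  by apply: (ridge_optimal s0); exact: ridge_rule_col.
rewrite (eq_integral (fun w => ((sqnorm (white_residual Z U Hh (ridge_rule Hh s) w))%:E +
   (s * dotc (rule_col Z U (ridge_rule Hh s) w) (rule_col Z U (ridge_rule Hh s) w))%:E)%E)
   (fun w => (q (ridge_rule Hh s) w)%:E)); last first.
  by move=> w _; rewrite -EFinD /q addrC.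
rewrite ge0_integralD//; last 4 first.
- by move=> w _; rewrite lee_fin sqnorm_ge0.
- by apply/measurable_EFinP; exact: mres.
- by move=> w _; rewrite lee_fin.
- by apply/measurable_EFinP; apply: measurable_funM => //; exact: mdot.
under [X in (X + _ <= _)%E]eq_integral do rewrite add0r.
apply: leeD => //.
under eq_integral do rewrite EFinM.
rewrite ge0_integralZl_EFin//; last 3 first.
- by move=> w _; rewrite lee_fin dotc_ge0.
- by apply/measurable_EFinP; exact: mdot.
- exact: ltW.
rewrite EFinM; apply: lee_wpmul2l; first by rewrite lee_fin ltW.
exact: ridge_rule_norm_ge.
Qed.

(** The competitor here is the zero rule: its noiseless risk is E|x_0|^2, finite by the second
    moments of the inputs. *)
Lemma ridge_excess_finite :
  (bayes_excess P false 0 (fun (_ : 'I_n) (_ : (d.-tuple R * n.-tuple (d.-tuple R)) * UT) => 0%R : R) th Z U < +oo)%E.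
Proof.
rewrite /bayes_excess sube0 (bayes_risk HhT HhE s0 real noise nu2 false)//.
have e w : white_residual Z U Hh (fun _ _ => 0 : R) w = white Hh (Z ord0 w).
  rewrite /white_residual (_ : rule_col _ _ _ w = 0) ?mulmx0 ?subr0//.
  by apply/matrixP => i j; rewrite !mxE.
have i0 : rintegrable mu (fun z => sqnorm (white Hh z)).
  apply: rintegrable_sum => a _.
  by have := rintegrable_white2 Hh mu2 a a.
have [_ _ lZ _] := real.
have := rintegrable_law (mZ ord0) (lZ ord0) i0.
rewrite (eq_integral (fun w => (sqnorm (white Hh (Z ord0 w)))%:E)); last first.
  by move=> w _; rewrite add0r e.
exact: integrable_lty.
Qed.

End OneRealization.

(** Nonnegative as an infimum of integrals of squares, and below the value of the zero rule on the
    constructed realization. Finiteness is what allows [Ebar0] to be moved across the inequality. *)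
Lemma Ebar0_fin_num : @Ebar0 R d n mu nu \is a fin_num.
Proof.
have lower : (0 <= @Ebar0 R d n mu nu)%E.
  apply: le_ereal_inf_tmp => v [dO [Om [P [dU [UT [th [Z [U [l [real ml ->]]]]]]]]]].
  by rewrite /bayes_excess sube0; apply: integral_ge0 => w _; rewrite lee_fin sqr_ge0.
rewrite ge0_fin_numE//.
have [dO [Om [P [th [Z [U real]]]]]] := @realization_exists R d n mu nu.
apply: le_lt_trans (ridge_excess_finite real); apply: ereal_inf_lbound.
exists dO, Om, P, _, unit, th, Z, U, (fun _ _ => 0 : R); split=> //.
Qed.

(** Each value in the infimum [Ebar] comes with a realization; on that same realization the ridge
    rule is a competitor for [Ebar0]. *)
Lemma excess_gap :
  ((s / n%:R * df2 Sg ((s + L2) / n%:R))%:E <= @Ebar R d n mu nu s - @Ebar0 R d n mu nu)%E.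
Proof.
rewrite leeBrDr ?Ebar0_fin_num//.
apply: le_ereal_inf_tmp => v [dO [Om [P [dU [UT [th [Z [U [l [real ml ->]]]]]]]]]].
apply: le_trans (noisy_excess_ge real ml).
rewrite addeC -mulrA; apply: leeD => //; apply: ereal_inf_lbound.
exists dO, Om, P, dU, UT, th, Z, U, (ridge_rule Hh s); split => //.
exact: measurable_ridge_rule.
Qed.

End Gap.

(** * From the gap with constant 1 to the constants of both cases *)

Lemma white_df2_ge0 {R : realType} {d : nat} (mu : probability (d.-tuple R * R)%type R)
    (Hh : 'M[R]_d) (lam : R) :
  (forall j : 'I_d, mu.-integrable setT (fun z => ((tnth z.1 j) ^+ 2)%:E)) ->
  Hh^T = Hh -> 0 < lam -> 0 <= df2 (Hh *m Sigma_of mu *m Hh) lam.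
Proof.
move=> mu2 HhT lam0.
have SgT := white_cov_sym mu2 HhT; have Sg0 := white_cov_quad_ge0 mu2 HhT.
rewrite df2E//; set C := invmx _.
have CT : C^T = C by rewrite /C trmx_inv linearD/= tr_scalar_mx SgT.
rewrite -2!mulmxA; apply: (white_cov_dual mu2 HhT).
by rewrite mulmxA -{1}CT; exact: quad_ge0_congr.
Qed.

Unset Implicit Arguments.

Theorem theorem2 (R : realType) (d n : nat)
  (mu : probability (d.-tuple R * R)%type R) (nu : probability (d.-tuple R) R)
  (A Hh : 'M[R]_d) (sigma2 LH : R) :
  (0 < n)%N -> 0 < sigma2 -> 0 < LH ->
  (* data model: finite second moments of X, E[eps|X] = 0, E[eps^2|X] = sigma2 *)
  (forall j : 'I_d, mu.-integrable setT (fun z => ((tnth z.1 j) ^+ 2)%:E)) ->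
  @noise_cond R d mu sigma2 ->
  (* prior nu supported on the ellipsoid {theta : ||A theta||_2 = 1}, A psd *)
  psd A ->
  {ae nu, forall t, Num.sqrt (sqnorm (A *m tcol t)) = 1} ->
  (forall j : 'I_d, nu.-integrable setT (fun t => ((tnth t j) ^+ 2)%:E)) ->
  (* Hh = H^{1/2}, H = E_nu[theta theta^T] *)
  psd Hh -> Hh *m Hh = H_of nu ->
  (* E[ ||Xt||^2 Xt Xt^T ] <= LH^2 Sigma_H  (Loewner order), Xt = H^{1/2} X *)
  (forall v : 'cV[R]_d,
     (\int[mu]_z ((sqnorm (Hh *m tcol z.1)) * ((v^T *m (Hh *m tcol z.1)) 0 0) ^+ 2)%:E
      <= (LH ^+ 2 * quad (Hh *m Sigma_of mu *m Hh) v)%:E)%E) ->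
  let SH := Hh *m Sigma_of mu *m Hh in
  (LH ^+ 2 < sigma2 ->
     (((1 - LH ^+ 2 / sigma2) * (sigma2 / n%:R) * df2 SH ((sigma2 + LH ^+ 2) / n%:R))%:E
       <= @Ebar R d n mu nu sigma2 - @Ebar0 R d n mu nu)%E) /\
  ({ae mu, forall z, sqnorm (Hh *m tcol z.1) <= LH ^+ 2} ->
     (((1 + LH ^+ 2 / sigma2) ^- 2 * (sigma2 / n%:R) * df2 SH (sigma2 / n%:R))%:E
       <= @Ebar R d n mu nu sigma2 - @Ebar0 R d n mu nu)%E).
Proof.
move=> n0 s0 L0 mu2 noise _ _ nu2 [HhT _] HhE K4 SH.
have L20 : 0 <= LH ^+ 2 by exact: sqr_ge0.
have nR0 : 0 < n%:R :> R by rewrite ltr0n.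
have gap := excess_gap n0 s0 L20 mu2 noise nu2 HhT HhE K4.
have sn0 : 0 < sigma2 / n%:R by rewrite divr_gt0.
split=> [Ls|_]; apply: le_trans gap; rewrite lee_fin -/SH.
  (* Case (i): [1 - LH ^+ 2 / sigma2] is at most 1 and multiplies a nonnegative quantity. *)
  rewrite -mulrA ler_piMl//.
    rewrite mulr_ge0 ?(ltW sn0)// white_df2_ge0// divr_gt0//.
    by rewrite ltr_wpDr.
  by rewrite gerBl divr_ge0// ltW.
(* Case (ii): this number is the ratio of the two regularisations, (sigma2 + LH^2) / n over sigma2 /
   n, and [df2_scale] costs its inverse square. *)
have k1 : 1 <= 1 + LH ^+ 2 / sigma2 by rewrite lerDl divr_ge0// ltW.
have -> : (sigma2 + LH ^+ 2) / n%:R = (1 + LH ^+ 2 / sigma2) * (sigma2 / n%:R).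
  by field; rewrite !lt0r_neq0.
rewrite mulrAC mulrC ler_wpM2l ?(ltW sn0)//.
apply: df2_scale => //.
- exact: white_cov_dual.
- exact: white_cov_sym.
- exact: white_cov_quad_ge0.
Qed.
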